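(* Let $a\in\mathbb{C}^\times$ and let $0\neq\zeta\in\mathrm{Hom}_{\mathrm{alg}}(\mathcal H_q'(+),\mathbb{C}(q^{1/2}))$. Then the $\mathcal H_q$-module $M^q_{\zeta,a}$ is irreducible.
   Context: Let $q$ be an indeterminate, $n\geq1$ and $\dot I=\{1,\dots,n\}$. The quantum Heisenberg algebra $\mathcal H'_q$ is the unital $\mathbb{C}(q^{1/2})$-algebra (a subalgebra of a non-twisted quantum affine algebra $\mathcal U_q(\hat{\mathfrak g})$ of rank $n$) generated by $h_{i,r}$ ($i\in\dot I$, $r\in\mathbb{Z}\setminus\{0\}$) and $\gamma^{\pm1/2}$, with $\gamma^{1/2}$ central and invertible and $[h_{i,r},h_{j,s}]=\delta_{ij}\delta_{r+s,0}\frac{\gamma^r-\gamma^{-r}}{q-q^{-1}}$. The algebra $\mathcal H_q$ is generated by $\mathcal H'_q$ and $D^{\pm1}$, with $Dh_{i,r}D^{-1}=q^rh_{i,r}$ and $D\gamma^{1/2}=\gamma^{1/2}D$. $\mathcal H_q'(+)$ is the subalgebra generated by the $h_{i,r}$ with $r>0$, and $\mathcal H_q'(\mathfrak b)$ is the subalgebra generated by $\mathcal H_q'(+)$ and $\gamma^{\pm1/2}$. The condition $\zeta\neq0$ means $\zeta(h_{i,r})\ne0$ for some $i\in\dot I$, $r>0$. For $a\in\mathbb{C}^\times$, let $\mathbb{C}_{(\zeta,a)}(q^{1/2})v=\mathbb{C}(q^{1/2})v$ be the one-dimensional $\mathcal H_q'(\mathfrak b)$-module with $yv=\zeta(y)v$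 for $y\in\mathcal H'_q(+)$ and $\gamma^{1/2}v=q^{a/2}v$. Then $M^q_{\zeta,a}=\mathcal H_q\otimes_{\mathcal H_q'(\mathfrak b)}\mathbb{C}_{(\zeta,a)}(q^{1/2})v$.
   Formalization: Since q^{a/2} lies in C(q^{1/2}) only for integral a, the ground field is any extension of C(q^{1/2}) with distinct powers q^b for b in an additive group of complex exponents containing 1/2 and a/2; for integral a it may be C(q^{1/2}) itself. *)

(* Defs.v *)
From HB Require Import structures.
From mathcomp Require Import all_boot all_order all_algebra.
From mathcomp Require Import generic_quotient complex.
From mathcomp Require Import boolp classical_sets functions reals.
From mathcomp Require Import ring zify.

Set Implicit Arguments.
Unset Strict Implicit.
Unset Printing Implicit Defensive.

Import Order.TTheory GRing.Theory Num.Theory.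
Local Open Scope ring_scope.
Local Open Scope quotient_scope.

Inductive aterm (F X : Type) : Type :=
| TGen of X
| TCst of F
| TAdd of aterm F X & aterm F X
| TOpp of aterm F X
| TMul of aterm F X & aterm F X.

Arguments TGen {F X}.
Arguments TCst {F X}.

Declare Scope aterm_scope.
Delimit Scope aterm_scope with A.
Bind Scope aterm_scope with aterm.
Notation "s + t" := (TAdd s t) : aterm_scope.
Notation "- t" := (TOpp t) : aterm_scope.
Notation "s - t" := (TAdd s (TOpp t)) : aterm_scope.
Notation "s * t" := (TMul s t) : aterm_scope.

Section TermPower.
Variables (F : pzRingType) (X : Type).

Fixpoint tpow (t : aterm F X) (k : nat) : aterm F X :=
  if k is k'.+1 then (t * tpow t k')%A else TCst 1.

End TermPower.

HB.instance Definition _ (F X : Type) := gen_eqMixin (aterm F X).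
HB.instance Definition _ (F X : Type) := gen_choiceMixin (aterm F X).

Section Presented.
Variables (F : comNzRingType) (X : Type).
Implicit Types s t u : aterm F X.
Variable rel : aterm F X -> aterm F X -> Prop.

(* The least congruence containing [rel] whose quotient is an F-algebra. *)
Inductive peq : aterm F X -> aterm F X -> Prop :=
| peq_rel s t of rel s t : peq s t
| peq_refl t : peq t t
| peq_sym s t of peq s t : peq t s
| peq_trans s t u of peq s t & peq t u : peq s u
| peq_add s s' t t' of peq s s' & peq t t' : peq (s + t)%A (s' + t')%A
| peq_opp s s' of peq s s' : peq (- s)%A (- s')%A
| peq_mul s s' t t' of peq s s' & peq t t' : peq (s * t)%A (s' * t')%A
| peq_addA s t u : peq (s + (t + u))%A (s + t + u)%A
| peq_addC s t : peq (s + t)%A (t + s)%A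
| peq_add0 t : peq (TCst 0 + t)%A t
| peq_addN t : peq (- t + t)%A (TCst 0)
| peq_mulA s t u : peq (s * (t * u))%A (s * t * u)%A
| peq_mul1 t : peq (TCst 1 * t)%A t
| peq_mulDl s t u : peq ((s + t) * u)%A (s * u + t * u)%A
| peq_mulDr s t u : peq (s * (t + u))%A (s * t + s * u)%A
| peq_cstD (c d : F) : peq (TCst (c + d)) (TCst c + TCst d)%A
| peq_cstM (c d : F) : peq (TCst (c * d)) (TCst c * TCst d)%A
| peq_cstC (c : F) t : peq (TCst c * t)%A (t * TCst c)%A.

Definition peqb s t := `[< peq s t >].

Lemma peqb_equiv : equiv_class_of peqb.
Proof.
split=> [t|s t|t s u].
- exact/asboolP/peq_refl.
- by apply/asboolP/asboolP; exact: peq_sym.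
- by move=> /asboolP st /asboolP tu; apply/asboolP; exact: peq_trans st tu.
Qed.

Canonical peq_equiv := EquivRelPack peqb_equiv.

Definition palg : Type := {eq_quot peq_equiv}.
HB.instance Definition _ := Choice.on palg.
HB.instance Definition _ := EqQuotient.on palg.

Definition pcls (t : aterm F X) : palg := \pi_palg t.

Lemma pclsP s t : pcls s = pcls t <-> peq s t.
Proof.
by split=> [/eqmodP/asboolP//|st]; apply/eqmodP/asboolP.
Qed.

Lemma pcls_repr (x : palg) : pcls (repr x) = x.
Proof. by rewrite /pcls reprK. Qed.

Definition padd (x y : palg) := pcls (repr x + repr y)%A.
Definition popp (x : palg) := pcls (- repr x)%A.
Definition pmul (x y : palg) := pcls (repr x * repr y)%A.
Definition pscale (c : F) (x : palg) := pcls (TCst c * repr x)%A.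

Lemma peq_repr t : peq (repr (pcls t)) t.
Proof. by apply/pclsP; rewrite pcls_repr. Qed.

Lemma pclsD s t : pcls (s + t)%A = padd (pcls s) (pcls t).
Proof. by apply/pclsP/peq_sym/peq_add; exact: peq_repr. Qed.
Lemma pclsN t : pcls (- t)%A = popp (pcls t).
Proof. by apply/pclsP/peq_sym/peq_opp; exact: peq_repr. Qed.
Lemma pclsM s t : pcls (s * t)%A = pmul (pcls s) (pcls t).
Proof. by apply/pclsP/peq_sym/peq_mul; exact: peq_repr. Qed.
Lemma pclsZ c t : pcls (TCst c * t)%A = pscale c (pcls t).
Proof.
by apply/pclsP/peq_sym/peq_mul; [exact: peq_refl|exact: peq_repr].
Qed.

Lemma pcls_ind (P : palg -> Prop) : (forall t, P (pcls t)) -> forall x, P x.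
Proof. by move=> Pt x; rewrite -(pcls_repr x). Qed.

Lemma paddA : associative padd.
Proof.
elim/pcls_ind=> s; elim/pcls_ind=> t; elim/pcls_ind=> u.
by rewrite -!pclsD; apply/pclsP/peq_addA.
Qed.
Lemma paddC : commutative padd.
Proof.
elim/pcls_ind=> s; elim/pcls_ind=> t.
by rewrite -!pclsD; apply/pclsP/peq_addC.
Qed.
Lemma padd0 : left_id (pcls (TCst 0)) padd.
Proof. by elim/pcls_ind=> s; rewrite -!pclsD; apply/pclsP/peq_add0. Qed.
Lemma paddN : left_inverse (pcls (TCst 0)) popp padd.
Proof. by elim/pcls_ind=> s; rewrite -pclsN -pclsD; apply/pclsP/peq_addN. Qed.

HB.instance Definition _ :=
  GRing.isZmodule.Build palg paddA paddC padd0 paddN.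

Lemma pmulA : associative pmul.
Proof.
elim/pcls_ind=> s; elim/pcls_ind=> t; elim/pcls_ind=> u.
by rewrite -!pclsM; apply/pclsP/peq_mulA.
Qed.
Lemma pmul1 : left_id (pcls (TCst 1)) pmul.
Proof. by elim/pcls_ind=> s; rewrite -!pclsM; apply/pclsP/peq_mul1. Qed.
Lemma pmul1r : right_id (pcls (TCst 1)) pmul.
Proof.
elim/pcls_ind=> s; rewrite -!pclsM; apply/pclsP.
exact: peq_trans (peq_sym (peq_cstC _ _)) (peq_mul1 _).
Qed.
Lemma pmulDl : left_distributive pmul padd.
Proof.
elim/pcls_ind=> s; elim/pcls_ind=> t; elim/pcls_ind=> u.
by rewrite -!(pclsM, pclsD); apply/pclsP/peq_mulDl.
Qed.
Lemma pmulDr : right_distributive pmul padd.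
Proof.
elim/pcls_ind=> s; elim/pcls_ind=> t; elim/pcls_ind=> u.
by rewrite -!(pclsM, pclsD); apply/pclsP/peq_mulDr.
Qed.

HB.instance Definition _ :=
  GRing.Zmodule_isPzRing.Build palg pmulA pmul1 pmul1r pmulDl pmulDr.

Lemma pscaleA c d x : pscale c (pscale d x) = pscale (c * d) x.
Proof.
elim/pcls_ind: x => t; rewrite -!pclsZ; apply/pclsP.
apply: (peq_trans (peq_mulA _ _ _)); apply: peq_mul (peq_refl _).
exact/peq_sym/peq_cstM.
Qed.
Lemma pscale1 : left_id 1 pscale.
Proof. by elim/pcls_ind=> t; rewrite -!pclsZ; apply/pclsP/peq_mul1. Qed.
Lemma pscaleDr : right_distributive pscale +%R.
Proof.
move=> c; elim/pcls_ind=> s; elim/pcls_ind=> t.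
by rewrite -[LHS]/(pscale c (padd _ _)) -pclsD -!pclsZ -[RHS]/(padd _ _) -pclsD;
  apply/pclsP/peq_mulDr.
Qed.
Lemma pscaleDl x : {morph pscale^~ x : c d / c + d}.
Proof.
elim/pcls_ind: x => t c d /=.
rewrite -!pclsZ -[RHS]/(padd _ _) -pclsD; apply/pclsP.
apply: (peq_trans _ (peq_mulDl _ _ _)).
exact: peq_mul (peq_cstD _ _) (peq_refl _).
Qed.

HB.instance Definition _ := GRing.Zmodule_isLmodule.Build F palg
  pscaleA pscale1 pscaleDr pscaleDl.

Lemma pscaleAl c (x y : palg) : c *: (x * y) = (c *: x) * y.
Proof.
elim/pcls_ind: x => s; elim/pcls_ind: y => t.
rewrite -[RHS]/(pmul (pscale _ _) _) -[LHS]/(pscale _ (pmul _ _)).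
by rewrite -!(pclsZ, pclsM); apply/pclsP/peq_mulA.
Qed.
Lemma pscaleAr c (x y : palg) : c *: (x * y) = x * (c *: y).
Proof.
elim/pcls_ind: x => s; elim/pcls_ind: y => t.
rewrite -[RHS]/(pmul _ (pscale _ _)) -[LHS]/(pscale _ (pmul _ _)).
rewrite -!(pclsZ, pclsM); apply/pclsP.
apply: (peq_trans (peq_mulA _ _ _)).
apply: (peq_trans _ (peq_sym (peq_mulA _ _ _))).
exact: peq_mul (peq_cstC _ _) (peq_refl _).
Qed.

Lemma pclsE_D s t : pcls (s + t)%A = pcls s + pcls t.
Proof. exact: pclsD. Qed.
Lemma pclsE_N t : pcls (- t)%A = - pcls t.
Proof. exact: pclsN. Qed.
Lemma pclsE_M s t : pcls (s * t)%A = pcls s * pcls t.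
Proof. exact: pclsM. Qed.
Lemma pclsE_1 : pcls (TCst 1) = 1.
Proof. by []. Qed.
Lemma pclsE_C c : pcls (TCst c) = c *: (1 : palg).
Proof.
rewrite -pclsE_1 -[RHS]/(pscale c (pcls _)) -pclsZ; apply/pclsP.
by apply: (peq_trans _ (peq_sym (peq_cstC _ _))); apply/peq_sym/peq_mul1.
Qed.

(* A linear action of the generators satisfying the relations extends to an
   action of the presented algebra. *)
Section Action.
Variables (W : lmodType F) (f : X -> W -> W).

Fixpoint tact (t : aterm F X) : W -> W :=
  match t with
  | TGen x => f x
  | TCst c => fun w => c *: w
  | TAdd s t => fun w => tact s w + tact t w
  | TOpp t => fun w => - tact t w
  | TMul s t => fun w => tact s (tact t w)
  end.

Hypothesis f_lin : forall x, linear (f x).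
Hypothesis f_rel : forall s t, rel s t -> forall w, tact s w = tact t w.

Lemma tact_lin t : linear (tact t).
Proof.
elim: t => [x|c|s IHs t IHt|t IHt|s IHs t IHt] d u v /=.
- exact: f_lin.
- by rewrite scalerDr !scalerA mulrC.
- by rewrite IHs IHt scalerDr addrACA.
- by rewrite IHt opprD scalerN.
- by rewrite IHt IHs.
Qed.

Lemma tactP s t : peq s t -> forall w, tact s w = tact t w.
Proof.
have tD t' (u v : W) : tact t' (u + v) = tact t' u + tact t' v.
  by have := tact_lin t' 1 u v; rewrite !scale1r.
have t0 t' : tact t' 0 = 0.
  by apply: (addrI (tact t' 0)); rewrite -tD !addr0.
have tZ t' c (u : W) : tact t' (c *: u) = c *: tact t' u.
  by have := tact_lin t' c u 0; rewrite t0 !addr0.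
elim=> {s t} /=.
- exact: f_rel.
- by [].
- by move=> s t _ IH w; rewrite IH.
- by move=> s t u _ IH1 _ IH2 w; rewrite IH1.
- by move=> s s' t t' _ IH1 _ IH2 w; rewrite IH1 IH2.
- by move=> s s' _ IH w; rewrite IH.
- by move=> s s' t t' _ IH1 _ IH2 w; rewrite IH2 IH1.
- by move=> s t u w; rewrite addrA.
- by move=> s t w; rewrite addrC.
- by move=> t w; rewrite scale0r add0r.
- by move=> t w; rewrite addNr scale0r.
- by [].
- by move=> t w; rewrite scale1r.
- by [].
- by move=> s t u w; rewrite tD.
- by move=> c d w; rewrite scalerDl.
- by move=> c d w; rewrite scalerA.
- by move=> c t w; rewrite tZ.
Qed.

Definition pact (x : palg) : W -> W := tact (repr x).

Lemma pact_cls t w : pact (pcls t) w = tact t w.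
Proof. exact/tactP/peq_repr. Qed.

Lemma pact_lin x : linear (pact x).
Proof. exact: tact_lin. Qed.

Lemma pactD x y w : pact (x + y) w = pact x w + pact y w.
Proof. by rewrite -[x + y]/(padd x y) pact_cls. Qed.
Lemma pactM x y w : pact (x * y) w = pact x (pact y w).
Proof. by rewrite -[x * y]/(pmul x y) pact_cls. Qed.
Lemma pactZ c x w : pact (c *: x) w = c *: pact x w.
Proof. by rewrite -[c *: x]/(pscale c x) pact_cls. Qed.
Lemma pact1 w : pact 1 w = w.
Proof. by rewrite -pclsE_1 pact_cls /= scale1r. Qed.

End Action.
End Presented.

Section Subalgebra.
Variables (F : comNzRingType) (A : algType F) (S : set A).

Inductive in_subalg : A -> Prop :=
| in_subalg_gen x of S x : in_subalg x
| in_subalg_cst c : in_subalg (c%:A)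
| in_subalg_add x y of in_subalg x & in_subalg y : in_subalg (x + y)
| in_subalg_mul x y of in_subalg x & in_subalg y : in_subalg (x * y).

Definition subalg_pred : {pred A} := fun x => `[< in_subalg x >].

Lemma subalg_predP x : reflect (in_subalg x) (x \in subalg_pred).
Proof. exact: asboolP. Qed.

Lemma subalg_closed_pred : subalg_closed subalg_pred.
Proof.
split=> [|c x y /subalg_predP Sx /subalg_predP Sy
         |x y /subalg_predP Sx /subalg_predP Sy]; apply/subalg_predP.
- by rewrite -(scale1r 1); exact: in_subalg_cst.
- apply: in_subalg_add => //; rewrite -mulr_algl.
  by apply: in_subalg_mul => //; exact: in_subalg_cst.
- exact: in_subalg_mul.
Qed.

HB.instance Definition _ :=
  GRing.isSubalgClosed.Build F A subalg_pred subalg_closed_pred.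

Definition subalg : Type := {x : A | x \in subalg_pred}.
HB.instance Definition _ := SubChoice.on subalg.
HB.instance Definition _ := [SubChoice_isSubAlgebra of subalg by <:].

End Subalgebra.

(* [tensor] below is [H ⊗_B V] along a ring morphism [f : B -> H], as a left
   H-module. *)
Inductive tterm (H V : Type) : Type :=
| TPure of H & V
| TZero
| TPlus of tterm H V & tterm H V
| TMinus of tterm H V.

Arguments TPure {H V}.
Arguments TZero {H V}.

HB.instance Definition _ (H V : Type) := gen_eqMixin (tterm H V).
HB.instance Definition _ (H V : Type) := gen_choiceMixin (tterm H V).

Section Tensor.
Variables (B H : pzRingType) (f : {rmorphism B -> H}) (V : lmodType B).
Implicit Types s t u : tterm H V.

(* The least congruence whose quotient is an abelian group in which pure
   tensors are biadditive and B-balanced. *)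
Inductive teq : tterm H V -> tterm H V -> Prop :=
| teq_refl t : teq t t
| teq_sym s t of teq s t : teq t s
| teq_trans s t u of teq s t & teq t u : teq s u
| teq_add s s' t t' of teq s s' & teq t t' : teq (TPlus s t) (TPlus s' t')
| teq_opp s s' of teq s s' : teq (TMinus s) (TMinus s')
| teq_addA s t u : teq (TPlus s (TPlus t u)) (TPlus (TPlus s t) u)
| teq_addC s t : teq (TPlus s t) (TPlus t s)
| teq_add0 t : teq (TPlus TZero t) t
| teq_addN t : teq (TPlus (TMinus t) t) TZero
| teq_pureDl x y v : teq (TPure (x + y) v) (TPlus (TPure x v) (TPure y v))
| teq_pureDr x v w : teq (TPure x (v + w)) (TPlus (TPure x v) (TPure x w))
| teq_pureM x b v : teq (TPure (x * f b) v) (TPure x (b *: v)).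

Definition teqb s t := `[< teq s t >].

Lemma teqb_equiv : equiv_class_of teqb.
Proof.
split=> [t|s t|t s u].
- exact/asboolP/teq_refl.
- by apply/asboolP/asboolP; exact: teq_sym.
- by move=> /asboolP st /asboolP tu; apply/asboolP; exact: teq_trans st tu.
Qed.

Canonical teq_equiv := EquivRelPack teqb_equiv.

Definition tensor : Type := {eq_quot teq_equiv}.
HB.instance Definition _ := Choice.on tensor.
HB.instance Definition _ := EqQuotient.on tensor.

Definition tcls t : tensor := \pi_tensor t.
Definition pure (x : H) (v : V) : tensor := tcls (TPure x v).

Lemma tclsP s t : tcls s = tcls t <-> teq s t.
Proof. by split=> [/eqmodP/asboolP//|st]; apply/eqmodP/asboolP. Qed.

Lemma tcls_repr (x : tensor) : tcls (repr x) = x.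
Proof. by rewrite /tcls reprK. Qed.

Lemma teq_repr t : teq (repr (tcls t)) t.
Proof. by apply/tclsP; rewrite tcls_repr. Qed.

Fixpoint tlact (x : H) (t : tterm H V) : tterm H V :=
  match t with
  | TPure y v => TPure (x * y) v
  | TZero => TZero
  | TPlus s t => TPlus (tlact x s) (tlact x t)
  | TMinus t => TMinus (tlact x t)
  end.

Definition tadd (x y : tensor) := tcls (TPlus (repr x) (repr y)).
Definition topp (x : tensor) := tcls (TMinus (repr x)).
Definition tscale (x : H) (y : tensor) := tcls (tlact x (repr y)).

Lemma tlactP x s t : teq s t -> teq (tlact x s) (tlact x t).
Proof.
elim=> {s t} /=; try by move=> *; constructor.
- by move=> s t u _ st _ tu; exact: teq_trans st tu.
- by move=> y z v; rewrite mulrDr; exact: teq_pureDl.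
- by move=> y b v; rewrite mulrA; exact: teq_pureM.
Qed.

Lemma tclsD s t : tcls (TPlus s t) = tadd (tcls s) (tcls t).
Proof. by apply/tclsP/teq_sym/teq_add; exact: teq_repr. Qed.
Lemma tclsN t : tcls (TMinus t) = topp (tcls t).
Proof. by apply/tclsP/teq_sym/teq_opp; exact: teq_repr. Qed.
Lemma tclsZ x t : tcls (tlact x t) = tscale x (tcls t).
Proof. by apply/tclsP/teq_sym/tlactP; exact: teq_repr. Qed.

Lemma tcls_ind (P : tensor -> Prop) : (forall t, P (tcls t)) -> forall x, P x.
Proof. by move=> Pt x; rewrite -(tcls_repr x). Qed.

Lemma taddA : associative tadd.
Proof.
elim/tcls_ind=> s; elim/tcls_ind=> t; elim/tcls_ind=> u.
by rewrite -!tclsD; apply/tclsP/teq_addA.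
Qed.
Lemma taddC : commutative tadd.
Proof.
elim/tcls_ind=> s; elim/tcls_ind=> t.
by rewrite -!tclsD; apply/tclsP/teq_addC.
Qed.
Lemma tadd0 : left_id (tcls TZero) tadd.
Proof. by elim/tcls_ind=> s; rewrite -!tclsD; apply/tclsP/teq_add0. Qed.
Lemma taddN : left_inverse (tcls TZero) topp tadd.
Proof. by elim/tcls_ind=> s; rewrite -tclsN -tclsD; apply/tclsP/teq_addN. Qed.

HB.instance Definition _ :=
  GRing.isZmodule.Build tensor taddA taddC tadd0 taddN.

Lemma tscaleA x y z : tscale x (tscale y z) = tscale (x * y) z.
Proof.
elim/tcls_ind: z => t; rewrite -!tclsZ; congr tcls.
elim: t => //= [a v|s -> t ->|t ->] //; by rewrite mulrA.
Qed.
Lemma tscale1 : left_id 1 tscale.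
Proof.
elim/tcls_ind=> t; rewrite -!tclsZ; congr tcls.
elim: t => //= [a v|s -> t ->|t ->] //; by rewrite mul1r.
Qed.
Lemma tscaleDr : right_distributive tscale +%R.
Proof.
move=> x; elim/tcls_ind=> s; elim/tcls_ind=> t.
rewrite -[LHS]/(tscale x (tadd _ _)) -[RHS]/(tadd _ _).
by rewrite -tclsD -!tclsZ -tclsD.
Qed.
Lemma tscaleDl z : {morph tscale^~ z : x y / x + y}.
Proof.
elim/tcls_ind: z => t x y /=; rewrite -!tclsZ.
elim: t => /= [a v||s IHs t IHt|t IHt].
- rewrite mulrDl -[RHS]/(tadd _ _) -tclsD; exact/tclsP/teq_pureDl.
- by rewrite -[tcls TZero]/(0 : tensor) addr0.
- rewrite !tclsD -!/(_ + _) IHs IHt.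
  exact: (@addrACA tensor).
- by rewrite !tclsN IHt; exact: (@opprD tensor).
Qed.

HB.instance Definition _ := GRing.Zmodule_isLmodule.Build H tensor
  tscaleA tscale1 tscaleDr tscaleDl.

End Tensor.

(* The field [K] regarded as the left B-module [K v] with [v = 1] and
   [b v = chi b v]. *)
Definition line (B K : pzRingType) (chi : {rmorphism B -> K}) : Type := K.

Section Line.
Variables (B K : pzRingType) (chi : {rmorphism B -> K}).

HB.instance Definition _ := GRing.Zmodule.on (line chi).

Definition line_scale (b : B) (v : line chi) : line chi := chi b * (v : K).

Lemma line_scaleA b c v : line_scale b (line_scale c v) = line_scale (b * c) v.
Proof. by rewrite /line_scale rmorphM mulrA. Qed.
Lemma line_scale1 : left_id 1 line_scale.
Proof. by move=> v; rewrite /line_scale rmorph1 mul1r. Qed.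
Lemma line_scaleDr : right_distributive line_scale +%R.
Proof. by move=> b v w; exact: mulrDr. Qed.
Lemma line_scaleDl v : {morph line_scale^~ v : b c / b + c}.
Proof. by move=> b c; rewrite /line_scale rmorphD; exact: mulrDl. Qed.

HB.instance Definition _ := GRing.Zmodule_isLmodule.Build B (line chi)
  line_scaleA line_scale1 line_scaleDr line_scaleDl.

End Line.

Definition irreducible_lmod (H : pzRingType) (M : lmodType H) : Prop :=
  (exists m : M, m != 0) /\
  forall N : {pred M}, submod_closed N ->
    (forall m, m \in N -> m = 0) \/ (forall m, m \in N).

(* [CC(q^{1/2})], with [q^{1/2}] the indeterminate. *)
Definition Cqhalf (R : realType) : fieldType := {fraction {poly R[i]}}.
Definition Xhalf (R : realType) : Cqhalf R := tofrac 'X.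

(* The scalar [q^{a/2}] lies in [CC(q^{1/2})] only for integral [a].  To give it
   a meaning for complex [a] we let the ground field be any extension of
   [CC(q^{1/2})] together with powers [q^b], for [b] in an additive group of
   complex exponents containing [1/2]; distinct powers are distinct because [q]
   is an indeterminate.  [qpowers_int] below is [CC(q^{1/2})] itself; the
   fraction field of the group algebra [CC[q^b : b in CC]] has all exponents. *)
Record qpowers (R : realType) := QPowers {
  qfield :> fieldType;
  qincl : {rmorphism Cqhalf R -> qfield};
  qexps : zmodClosed R[i];
  qpow : R[i] -> qfield;
  half_qexps : 2^-1 \in qexps;
  qpowD : {in qexps &, forall b c, qpow (b + c) = qpow b * qpow c};
  qpow_half : qpow 2^-1 = qincl (Xhalf R);
  qpow_inj : {in qexps &, injective qpow}
}.

Lemma Xhalf_neq0 (R : realType) : Xhalf R != 0.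
Proof. by rewrite tofrac_eq0 polyX_eq0. Qed.

Section QPowersTheory.
Variables (R : realType) (P : qpowers R).

Definition qhalf : P := qincl P (Xhalf R).
Definition qq : P := qhalf ^+ 2.

Lemma qhalf_neq0 : qhalf != 0.
Proof. by rewrite fmorph_eq0 Xhalf_neq0. Qed.

Lemma qq_neq0 : qq != 0.
Proof. by rewrite expf_neq0 // qhalf_neq0. Qed.

Lemma qpow_neq0 b : b \in qexps P -> qpow P b != 0.
Proof.
move=> bP; apply: contra_neq qhalf_neq0 => qb0.
have -> : qhalf = qpow P (b + (2^-1 - b)).
  by rewrite addrC subrK qpow_half.
by rewrite qpowD ?qb0 ?mul0r// rpredB // half_qexps.
Qed.

End QPowersTheory.

Section IntegralPowers.
Variable R : realType.

Definition half_int : {pred R[i]} :=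
  fun b => `[< exists m : int, b = m%:~R / 2 >].

Lemma half_int_zmod : zmod_closed half_int.
Proof.
split=> [|b c /asboolP[m ->] /asboolP[k ->]]; apply/asboolP.
  by exists 0; rewrite mul0r.
by exists (m - k); rewrite rmorphB /= mulrBl.
Qed.

HB.instance Definition _ := GRing.isZmodClosed.Build R[i] half_int half_int_zmod.

Definition int_pow (b : R[i]) : Cqhalf R :=
  (Xhalf R) ^ xget 0 [set m : int | b = m%:~R / 2].

Lemma int_powE (m : int) : int_pow (m%:~R / 2) = (Xhalf R) ^ m.
Proof.
have two : (2^-1 : R[i]) != 0 by rewrite invr_eq0 pnatr_eq0.
rewrite /int_pow; case: xgetP => [k _ /= /(mulIf two) /eqP|/(_ m) /=//].
by rewrite eqr_int => /eqP ->.
Qed.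

Lemma int_powD :
  {in half_int &, forall b c, int_pow (b + c) = int_pow b * int_pow c}.
Proof.
move=> b c /asboolP[m ->] /asboolP[k ->].
rewrite -mulrDl -rmorphD /= !int_powE expfzDr //.
exact: Xhalf_neq0.
Qed.

Lemma int_pow_half : int_pow 2^-1 = idfun (Xhalf R).
Proof. by rewrite -[2^-1]mul1r -[1]/(1%:~R) int_powE expr1z. Qed.

Lemma half_in_int : 2^-1 \in half_int.
Proof. by apply/asboolP; exists 1; rewrite mul1r. Qed.

Lemma Xfrac_expz_eq1 (m : int) : (Xhalf R) ^ m = 1 :> Cqhalf R -> m = 0.
Proof.
have nat_case k : (Xhalf R) ^+ k = 1 :> Cqhalf R -> k = 0%N.
  rewrite -rmorphXn -[1](rmorph1 (@tofrac {poly R[i]})) => /eqP.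
  rewrite tofrac_eq => /eqP /(congr1 (fun p : {poly _} => size p)).
  by rewrite size_polyXn size_poly1 => -[].
case: m => k; first by move/nat_case ->.
by rewrite NegzE -exprnN => /eqP; rewrite invr_eq1 => /eqP /nat_case.
Qed.

Lemma int_pow_inj : {in half_int &, injective int_pow}.
Proof.
move=> b c /asboolP[m ->] /asboolP[k ->]; rewrite !int_powE => mk.
have X0 := Xhalf_neq0 R.
suff /eqP : m - k = 0 by rewrite subr_eq0 => /eqP ->.
apply: Xfrac_expz_eq1; rewrite expfzDr // mk -expfzDr // subrr.
by rewrite expr0z.
Qed.

Definition qpowers_int : qpowers R :=
  QPowers half_in_int int_powD int_pow_half int_pow_inj.

End IntegralPowers.

Definition nzint : Type := {r : int | r != 0}.
HB.instance Definition _ := SubChoice.on nzint.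

(* [GGamma] and [GGammaV] stand for [gamma^{1/2}] and [gamma^{-1/2}]; [H_q] is
   presented directly by the generators of [H'_q] together with [D^{+-1}]. *)
Inductive heis_gen (n : nat) : Type :=
| GH of 'I_n & nzint
| GGamma
| GGammaV
| GD
| GDV.

Arguments GGamma {n}.
Arguments GGammaV {n}.
Arguments GD {n}.
Arguments GDV {n}.

Section Heisenberg.
Variables (R : realType) (P : qpowers R) (n : nat).
Local Notation K := (qfield P).
Local Notation q := (qq P).
Local Notation T := (aterm K (heis_gen n)).

Definition tH (i : 'I_n) (r : nzint) : T := TGen (GH i r).
Definition tG : T := TGen GGamma.
Definition tGV : T := TGen GGammaV.
Definition tD : T := TGen GD.
Definition tDV : T := TGen GDV.

Definition tgamma (r : int) : T :=
  match r with
  | Posz k => tpow tG k.*2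
  | Negz k => tpow tGV k.+1.*2
  end.

Inductive heis_rel : T -> T -> Prop :=
| rel_GGV : heis_rel (tG * tGV)%A (TCst 1)
| rel_GVG : heis_rel (tGV * tG)%A (TCst 1)
| rel_Gh i r : heis_rel (tG * tH i r)%A (tH i r * tG)%A
| rel_hh i r j s :
    heis_rel (tH i r * tH j s - tH j s * tH i r)%A
      (TCst (((i == j) && (val r + val s == 0))%:R / (q - q^-1))%R
         * (tgamma (val r) - tgamma (- val r)%R))%A
| rel_DDV : heis_rel (tD * tDV)%A (TCst 1)
| rel_DVD : heis_rel (tDV * tD)%A (TCst 1)
| rel_Dh i r : heis_rel (tD * tH i r * tDV)%A (TCst (q ^ val r)%R * tH i r)%A
| rel_DG : heis_rel (tD * tG)%A (tG * tD)%A.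

Definition heis : Type := palg heis_rel.
HB.instance Definition _ := GRing.PzRing.on heis.
HB.instance Definition _ := GRing.Lmodule.on heis.

Definition aug_act (x : heis_gen n) : K^o -> K^o :=
  if x is GH _ _ then fun=> 0 else id.

Lemma aug_rel s t : heis_rel s t -> forall w, tact aug_act s w = tact aug_act t w.
Proof.
have Gk k w : tact aug_act (tpow tG k) w = w.
  by elim: k => [|k IH] /=; rewrite ?scale1r.
have GVk k w : tact aug_act (tpow tGV k) w = w.
  by elim: k => [|k IH] /=; rewrite ?scale1r.
have G r w : tact aug_act (tgamma r) w = w by case: r => k; rewrite ?Gk ?GVk.
case=> [||i r|i r j s'|||i r|] w; rewrite /= ?scale1r ?scaler0 //.
by rewrite !G !subrr scaler0.
Qed.

Lemma heis_nonzero : (1 : heis) != 0.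
Proof.
have lin x : linear (aug_act x).
  by case: x => [i r||||] c u v //=; rewrite scaler0 addr0.
apply/eqP=> h.
have := pact1 lin aug_rel (1 : K^o); rewrite h -[0]/(pcls _ (TCst 0)).
rewrite (pact_cls lin aug_rel) /= scale0r => /eqP.
by rewrite eq_sym oner_eq0.
Qed.

HB.instance Definition _ := GRing.PzSemiRing_isNonZero.Build heis heis_nonzero.
HB.instance Definition _ := GRing.Lmodule_isLalgebra.Build K heis
  (@pscaleAl K (heis_gen n) heis_rel).
HB.instance Definition _ := GRing.Lalgebra_isAlgebra.Build K heis
  (@pscaleAr K (heis_gen n) heis_rel).

Definition hgen (i : 'I_n) (r : nzint) : heis := pcls heis_rel (tH i r).
Definition gammah : heis := pcls heis_rel tG.
Definition gammahV : heis := pcls heis_rel tGV.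
Definition Dgen : heis := pcls heis_rel tD.
Definition DgenV : heis := pcls heis_rel tDV.

(* [H'_q(+)] and [H'_q(b)], as subalgebras of [H_q]. *)
Definition plus_gens : set heis :=
  [set x | exists i r, 0 < val r /\ x = hgen i r]%classic.
Definition heis_plus := subalg plus_gens.

Definition bor_gens : set heis :=
  [set x | in_subalg plus_gens x \/ x = gammah \/ x = gammahV]%classic.
Definition heis_bor := subalg bor_gens.

Lemma hgen_plusP i (r : nzint) : 0 < val r -> hgen i r \in subalg_pred plus_gens.
Proof. by move=> r0; apply/subalg_predP/in_subalg_gen; exists i, r. Qed.

Definition hplus (i : 'I_n) (r : nzint) (r0 : 0 < val r) : heis_plus :=
  exist _ (hgen i r) (hgen_plusP i r0).

Definition hom_plus := {lrmorphism heis_plus -> K | *%R}.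

Definition hom_nonzero (zeta : hom_plus) : Prop :=
  exists (i : 'I_n) (r : nzint) (r0 : 0 < val r), zeta (hplus i r0) != 0.

(* The character of [H'_q(b)] extending [zeta], with [gamma^{1/2}] acting by a
   nonzero scalar [g].  It is read off the vacuum of a Fock space on which [H_q]
   acts: functions [f l m], for [l : int] (powers of [D]) and occupation numbers
   [m] of the modes [(i, k)]. *)
Section Fock.
Variables (zeta : hom_plus) (g : K).
Hypothesis g_neq0 : g != 0.

Definition occ := 'I_n -> nat -> nat.
Definition occ_up (i : 'I_n) (k : nat) (m : occ) : occ :=
  fun j l => (m j l + ((j == i) && (l == k)))%N.
Definition occ_dn (i : 'I_n) (k : nat) (m : occ) : occ :=
  fun j l => (m j l - ((j == i) && (l == k)))%N.

Definition gpow (r : int) : K := g ^ (r * 2).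
Definition hcoef (r : int) : K := (gpow r - gpow (- r)) / (q - q^-1).

Definition zval (i : 'I_n) (r : nzint) : K :=
  match pselect (0 < val r) with
  | left r0 => zeta (hplus i r0)
  | right _ => 0
  end.

Definition hmode (i : 'I_n) (r : nzint) (u : occ -> K) (m : occ) : K :=
  if 0 < val r then zval i r * u m + u (occ_up i `|val r|%N m)
  else hcoef (- val r) * (m i `|val r|%N)%:R * u (occ_dn i `|val r|%N m).

Definition fock := int -> occ -> K^o.

Definition fock_act (x : heis_gen n) : fock -> fock :=
  match x with
  | GH i r => fun f l m => q ^ (val r * l) * hmode i r (f l) m
  | GGamma => fun f l m => g * f l m
  | GGammaV => fun f l m => g^-1 * f l m
  | GD => fun f l m => f (l + 1) m
  | GDV => fun f l m => f (l - 1) m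
  end.

Lemma fockE (f1 f2 : fock) : (forall l m, f1 l m = f2 l m) -> f1 = f2.
Proof. by move=> h; apply/funext=> l; apply/funext=> m. Qed.

Lemma hmodeZ i r c u m : hmode i r (fun m => c * u m) m = c * hmode i r u m.
Proof. by rewrite /hmode; case: ifP => _; ring. Qed.

Lemma hmodeD i r u v m : hmode i r (fun m => u m + v m) m = hmode i r u m + hmode i r v m.
Proof. by rewrite /hmode; case: ifP => _; ring. Qed.

Lemma fock_act_lin x : linear (fock_act x).
Proof.
move=> c u v; apply: fockE => l m.
case: x => [i r||||] /=; rewrite -[RHS]/(c * _ + _) /=.
- rewrite -[hmode _ _ _ _]/(hmode i r (fun m => c * u l m + v l m) m).
  by rewrite hmodeD hmodeZ; ring.
- by rewrite -[_ l m]/(c * u l m + v l m); ring.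
- by rewrite -[_ l m]/(c * u l m + v l m); ring.
- by [].
- by [].
Qed.

Lemma hcoefN r : hcoef (- r) = - hcoef r.
Proof. by rewrite /hcoef opprK -mulNr opprB. Qed.

Lemma occ_upC i k j l m : occ_up i k (occ_up j l m) = occ_up j l (occ_up i k m).
Proof. by apply/funext=> s; apply/funext=> t; rewrite /occ_up addnAC. Qed.
Lemma occ_dnC i k j l m : occ_dn i k (occ_dn j l m) = occ_dn j l (occ_dn i k m).
Proof. by apply/funext=> s; apply/funext=> t; rewrite /occ_dn subnAC. Qed.
Lemma occ_upK i k m : occ_dn i k (occ_up i k m) = m.
Proof. by apply/funext=> s; apply/funext=> t; rewrite /occ_dn /occ_up addnK. Qed.
Lemma occ_dnK i k m : (0 < m i k)%N -> occ_up i k (occ_dn i k m) = m.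
Proof.
move=> m0; apply/funext=> s; apply/funext=> t; rewrite /occ_dn /occ_up.
by case: eqP => [->|_]; case: eqP => [->|_] /=; rewrite ?subn0 ?addn0 // subnK.
Qed.
Lemma occ_updn i k j l m : (i, k) != (j, l) ->
  occ_dn j l (occ_up i k m) = occ_up i k (occ_dn j l m).
Proof.
move=> ne; apply/funext=> s; apply/funext=> t; rewrite /occ_dn /occ_up.
have [/andP[/eqP-> /eqP->]|_] := boolP ((s == i) && (t == k)).
  by move: ne; rewrite xpair_eqE => /negbTE ->; rewrite !subn0.
by rewrite !addn0.
Qed.

Lemma hmode_mixed i (r : nzint) j (s : nzint) u m : 0 < val r -> ~~ (0 < val s) ->
  hmode i r (hmode j s u) m - hmode j s (hmode i r u) m
  = ((i == j) && (val r + val s == 0))%:R * hcoef (val r) * u m.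
Proof.
move=> r0 s0; rewrite /hmode r0 (negbTE s0).
have s1 : val s < 0 by rewrite lt_neqAle (valP s) leNgt.
have eqE : (i == j) && (val r + val s == 0)
         = ((i, `|val r|%N) == (j, `|val s|%N)).
  rewrite xpair_eqE; congr (_ && _); apply/eqP/eqP; lia.
rewrite eqE; case: eqP => [[<- rs0]|/eqP ne].
  have rs : (`|val r| = `|val s|)%N := rs0.
  have -> : - val s = val r by lia.
  rewrite -rs occ_upK {1}/occ_up !eqxx /= natrD.
  have [m0|m0] := posnP (m i `|val r|%N); first by rewrite m0; ring.
  by rewrite occ_dnK //; ring.
rewrite occ_updn // {1}/occ_up.
move: ne; rewrite eq_sym xpair_eqE => /negbTE ->; rewrite addn0 /=; ring.
Qed.

Lemma hmode_comm i (r : nzint) j (s : nzint) u m :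
  hmode i r (hmode j s u) m - hmode j s (hmode i r u) m
  = ((i == j) && (val r + val s == 0))%:R * hcoef (val r) * u m.
Proof.
have [r0|r0] := boolP (0 < val r); have [s0|s0] := boolP (0 < val s).
- have -> : (val r + val s == 0) = false by apply/eqP; lia.
  rewrite andbF /hmode r0 s0 occ_upC /=; ring.
- exact: hmode_mixed.
- rewrite -opprB hmode_mixed // [j == i]eq_sym [val s + _]addrC.
  case: eqP => [_|_]; last by rewrite !mul0r oppr0.
  case: eqP => [rs|_]; last by rewrite !mul0r oppr0.
  have -> : val r = - val s by lia.
  by rewrite hcoefN; ring.
- have r1 : val r < 0 by rewrite lt_neqAle (valP r) leNgt.
  have s1 : val s < 0 by rewrite lt_neqAle (valP s) leNgt.
  have -> : (val r + val s == 0) = false by apply/eqP; lia.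
  rewrite andbF /hmode (negbTE r0) (negbTE s0) occ_dnC /occ_dn /=.
  rewrite [_ == j]eq_sym [`|val s|%N == _]eq_sym.
  case: eqP => [->|_] /=; last by rewrite !subn0; ring.
  case: eqP => [->|_] /=; last by rewrite !subn0; ring.
  ring.
Qed.

Lemma tact_gamma r f l m : tact fock_act (tgamma r) f l m = gpow r * f l m.
Proof.
have Gk k : tact fock_act (tpow tG k) f l m = g ^+ k * f l m.
  elim: k => [|k IH] /=; first by rewrite expr0.
  by rewrite IH exprS mulrA.
have GVk k : tact fock_act (tpow tGV k) f l m = g ^- k * f l m.
  elim: k => [|k IH] /=; first by rewrite expr0 invr1.
  by rewrite IH exprS invfM mulrA.
rewrite /gpow; case: r => k; first by rewrite Gk -muln2.
rewrite GVk NegzE mulNr -exprnN -muln2; congr (_ * _).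
Qed.

Lemma fock_scale c (f : fock) l m : (c *: f) l m = c * f l m.
Proof. by []. Qed.
Lemma fock_add (f h : fock) l m : (f + h) l m = f l m + h l m.
Proof. by []. Qed.
Lemma fock_opp (f : fock) l m : (- f) l m = - f l m.
Proof. by []. Qed.

Lemma tact_cst c t f l m :
  tact fock_act (TCst c * t)%A f l m = c * tact fock_act t f l m.
Proof. by rewrite -fock_scale. Qed.
Lemma tact_sub s t f l m :
  tact fock_act (s - t)%A f l m = tact fock_act s f l m - tact fock_act t f l m.
Proof. by rewrite -fock_opp -fock_add. Qed.
Lemma tact_mul s t f :
  tact fock_act (s * t)%A f = tact fock_act s (tact fock_act t f).
Proof. by []. Qed.
Lemma tact_h i r f l m :
  tact fock_act (tH i r) f l m = q ^ (val r * l) * hmode i r (f l) m.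
Proof. by []. Qed.
Lemma hmode_fock i r j s' f l m :
  hmode i r (tact fock_act (tH j s') f l) m
  = q ^ (val s' * l) * hmode i r (hmode j s' (f l)) m.
Proof. exact: hmodeZ. Qed.
Lemma tact_one f l m : tact fock_act (TCst 1) f l m = f l m.
Proof. by rewrite -[RHS]mul1r -fock_scale. Qed.

Lemma fock_rel s t : heis_rel s t ->
  forall f, tact fock_act s f = tact fock_act t f.
Proof.
case=> [||i r|i r j s'|||i r|] f; apply: fockE => l m.
- by rewrite tact_one /= mulrA mulfV // mul1r.
- by rewrite tact_one /= mulrA mulVf // mul1r.
- by rewrite /= hmodeZ; ring.
- rewrite tact_cst !tact_sub !tact_gamma !tact_mul !tact_h !hmode_fock.
  rewrite [X in _ - X]mulrCA -mulrBr -mulrBr hmode_comm /hcoef.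
  case: eqP => [_|_]; last by rewrite !mul0r !mulr0.
  case: eqP => [rs|_]; last by rewrite !mul0r !mulr0.
  have -> : val s' = - val r by lia.
  have h : q ^ (val r * l) * q ^ (- val r * l) = 1.
    by rewrite -expfzDr ?qq_neq0 // mulNr subrr expr0z.
  by rewrite mulrA h; ring.
- by rewrite tact_one /= addrK.
- by rewrite tact_one /= subrK.
- rewrite tact_cst tact_h !tact_mul /= addrK.
  by rewrite mulrDr mulr1 addrC expfzDr ?qq_neq0 // mulrA.
- by [].
Qed.

Definition fock_lact (x : heis) : fock -> fock := pact (rel := heis_rel) fock_act x.

Definition vacuum : fock := fun l m =>
  ((l == 0) && `[< m = fun _ _ => 0%N >])%:R.

Lemma vacuum0 : vacuum 0 (fun _ _ => 0%N) = 1.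
Proof. by rewrite /vacuum eqxx /=; case: asboolP. Qed.

Lemma vacuum_up l i k m : vacuum l (occ_up i k m) = 0.
Proof.
rewrite /vacuum; case: asboolP => [/(congr1 (fun f => f i k))|_].
  by rewrite /occ_up !eqxx /= addn1.
by rewrite andbF.
Qed.

Let lactD := pactD fock_act_lin fock_rel.
Let lactM := pactM fock_act_lin fock_rel.
Let lactZ := pactZ fock_act_lin fock_rel.
Let lact1 := pact1 fock_act_lin fock_rel.
Let lact_cls := pact_cls fock_act_lin fock_rel.

Lemma lact_scal (x : heis) c d f : fock_lact x f = c *: f ->
  fock_lact x (d *: f) = d *: (c *: f).
Proof.
move=> <-; rewrite /fock_lact.
have h0 : pact fock_act x 0 = 0.
  have := pact_lin fock_act_lin x (-1) 0 0.
  by rewrite scaler0 addr0 scaleN1r addNr.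
have := pact_lin fock_act_lin x d f 0.
by rewrite h0 !addr0.
Qed.

Lemma hplus_vacuum i (r : nzint) (r0 : 0 < val r) :
  fock_lact (hgen i r) vacuum = zeta (hplus i r0) *: vacuum.
Proof.
rewrite /fock_lact /hgen lact_cls; apply: fockE => l m.
rewrite fock_scale /= /hmode r0 vacuum_up addr0.
have -> : zval i r = zeta (hplus i r0).
  by rewrite /zval; case: pselect => // r1; congr (zeta (hplus i _)).
have [->|/negbTE l0] := eqVneq l 0; first by rewrite mulr0 expr0z mul1r.
by rewrite /vacuum l0 /= !mulr0.
Qed.

Lemma plus_vacuum (y : heis_plus) : fock_lact (val y) vacuum = zeta y *: vacuum.
Proof.
have : in_subalg plus_gens (val y) by exact/subalg_predP/(valP y).
move: {-2}(val y) (erefl (val y)) => x + xS; move: y.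
elim: xS => {x} [x [i [r [r0 ->]]] y yx|c y yx|x1 x2 S1 IH1 S2 IH2 y yx
                |x1 x2 S1 IH1 S2 IH2 y yx].
- have -> : y = hplus i r0 by exact/val_inj.
  exact: hplus_vacuum.
- have -> : y = c%:A by apply/val_inj; rewrite -yx.
  by rewrite linearZ /= rmorph1 mulr1 /fock_lact lactZ lact1.
- pose y1 : heis_plus := exist _ x1 (introT (subalg_predP _ _) S1).
  pose y2 : heis_plus := exist _ x2 (introT (subalg_predP _ _) S2).
  have -> : y = y1 + y2 by exact/val_inj.
  by rewrite rmorphD scalerDl /fock_lact lactD -(IH1 y1) // -(IH2 y2).
- pose y1 : heis_plus := exist _ x1 (introT (subalg_predP _ _) S1).
  pose y2 : heis_plus := exist _ x2 (introT (subalg_predP _ _) S2).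
  have -> : y = y1 * y2 by exact/val_inj.
  rewrite rmorphM /fock_lact lactM [pact _ x2 _](IH2 y2) //.
  by rewrite -[LHS]/(fock_lact x1 _) (lact_scal _ (IH1 y1 _)) // scalerA mulrC.
Qed.

Lemma bor_vacuum_ex (x : heis) : in_subalg bor_gens x ->
  exists c : K, fock_lact x vacuum = c *: vacuum.
Proof.
elim=> {x} [x [xS|[->|->]]|c|x1 x2 S1 [c1 IH1] S2 [c2 IH2]
           |x1 x2 S1 [c1 IH1] S2 [c2 IH2]].
- pose y : heis_plus := exist _ x (introT (subalg_predP _ _) xS).
  by exists (zeta y); exact: (plus_vacuum y).
- by exists g; rewrite /fock_lact lact_cls.
- by exists g^-1; rewrite /fock_lact lact_cls.
- by exists c; rewrite /fock_lact lactZ lact1.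
- exists (c1 + c2); rewrite scalerDl /fock_lact lactD.
  by rewrite -[X in X + _]/(fock_lact x1 _) -[X in _ + X]/(fock_lact x2 _) IH1 IH2.
- exists (c2 * c1); rewrite /fock_lact lactM [pact _ x2 _]IH2.
  by rewrite -[LHS]/(fock_lact x1 _) (lact_scal _ IH1) scalerA.
Qed.

Definition vac_coef (b : heis_bor) : K :=
  fock_lact (val b) vacuum 0 (fun _ _ => 0%N).

Lemma vac_coefP (x : heis) c : fock_lact x vacuum = c *: vacuum ->
  fock_lact x vacuum 0 (fun _ _ => 0%N) = c.
Proof. by move=> ->; rewrite fock_scale vacuum0 mulr1. Qed.

Lemma bor_vacuum (b : heis_bor) : fock_lact (val b) vacuum = vac_coef b *: vacuum.
Proof.
have /bor_vacuum_ex[c h] : in_subalg bor_gens (val b).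
  exact/subalg_predP/(valP b).
by rewrite /vac_coef (vac_coefP h).
Qed.

Lemma vac_coefB : zmod_morphism vac_coef.
Proof.
move=> b c; apply: vac_coefP.
rewrite [val _]rmorphB /= scalerBl /fock_lact lactD -[- val c]scaleN1r lactZ.
by rewrite scaleN1r -!bor_vacuum.
Qed.
Lemma vac_coefM : monoid_morphism vac_coef.
Proof.
split=> [|b c]; apply: vac_coefP.
  by rewrite [val _]rmorph1 /fock_lact lact1 scale1r.
rewrite [val _]rmorphM /fock_lact lactM [pact _ (val c) _]bor_vacuum.
by rewrite -[LHS]/(fock_lact (val b) _) (lact_scal _ (bor_vacuum b)) scalerA mulrC.
Qed.
Lemma vac_coefZ : scalable_for *%R vac_coef.
Proof.
move=> c b; apply: vac_coefP.
by rewrite [val _]linearZ /fock_lact lactZ [pact _ (val b) _]bor_vacuum scalerA.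
Qed.

HB.instance Definition _ := GRing.isZmodMorphism.Build heis_bor K vac_coef vac_coefB.
HB.instance Definition _ := GRing.isMonoidMorphism.Build heis_bor K vac_coef vac_coefM.
HB.instance Definition _ := GRing.isScalable.Build K heis_bor K *%R vac_coef vac_coefZ.

Lemma bor_char_exists : exists chi : {lrmorphism heis_bor -> K | *%R},
  (forall (b : heis_bor) (y : heis_plus), val b = val y -> chi b = zeta y) /\
  (forall b : heis_bor, val b = gammah -> chi b = g).
Proof.
exists vac_coef; split=> [b y by_|b bg] /=; apply: vac_coefP.
- by rewrite by_ plus_vacuum.
- by rewrite bg /fock_lact lact_cls.
Qed.

End Fock.

Section Verma.
Variables (a : R[i]) (a_exp : a / 2 \in qexps P) (zeta : hom_plus).

(* The character by which [H'_q(b)] acts on [CC_(zeta,a)(q^{1/2}) v]. *)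
Definition bor_char : {lrmorphism heis_bor -> K | *%R} :=
  sval (cid (bor_char_exists zeta (qpow_neq0 a_exp))).

Lemma bor_charP :
  (forall (b : heis_bor) (y : heis_plus), val b = val y -> bor_char b = zeta y) /\
  (forall b : heis_bor, val b = gammah -> bor_char b = qpow P (a / 2)).
Proof. exact: svalP (cid (bor_char_exists zeta (qpow_neq0 a_exp))). Qed.

Definition bor_incl : heis_bor -> heis := val.
HB.instance Definition _ := GRing.RMorphism.on bor_incl.

(* [M^q_{zeta,a}], the tensor product of [H_q] over [H'_q(b)] with
   [CC_(zeta,a)(q^{1/2}) v]. *)
Definition Mq : lmodType heis := tensor bor_incl (line bor_char).

End Verma.
End Heisenberg.

(* Main.v *)
(* Write v for the generator. On D^l H'_q v the operator
   h_{i,r} - q^{-rl} zeta(h_{i,r}), r > 0, is locally nilpotent, since it lowers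
   the number of creation operators h_{j,-s}. For zeta(h_{i,r}) <> 0 the generalized
   eigenvalues q^{-rl} zeta(h_{i,r}) are distinct, so a nonzero submodule contains
   an eigenvector of h_{i,r}, which after a shift by a power of D lies in H'_q v.
   There one applies operators h_{j,s} - zeta(h_{j,s}) until all of them vanish; what
   is left is a multiple of v, as is seen with the number operator
   sum c_s^-1 h_{j,-s} (h_{j,s} - zeta(h_{j,s})), which needs the central charge
   c_s = (q^{as} - q^{-as}) / (q - q^-1) to be nonzero, that is, a <> 0. That v
   itself is nonzero is seen on the Fock space. *)
Require Import Defs.
From mathcomp Require Import all_boot all_order all_algebra complex reals.
From mathcomp Require Import boolp functions zify.

Import GRing.Theory Num.Theory.
Local Open Scope ring_scope.

Set Implicit Arguments.
Unset Strict Implicit.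
Unset Printing Implicit Defensive.

(** * Spans and polynomials of operators over the ground field *)

Section ScalarSpan.
Variables (K : fieldType) (A : algType K) (M : lmodType A).
Implicit Types (G : M -> Prop) (x : A) (m u : M) (c k : K).

Lemma scale_scal_comm x c m : x *: (c%:A *: m) = c%:A *: (x *: m).
Proof. by rewrite !scalerA mulr_algr mulr_algl. Qed.

Lemma scale_scalA c k m : c%:A *: (k%:A *: m) = (c * k)%:A *: m.
Proof. by rewrite scalerA mulr_algl scalerA. Qed.

Lemma scale_algZ c x m : (c *: x) *: m = c%:A *: (x *: m).
Proof. by rewrite scalerA mulr_algl. Qed.

(** [M] is a module over [A] only, so [K] acts through the scalars [c%:A]. These commute with every
    operator, so a span is stable under [x] as soon as its generators are. *)
Inductive scal_span G : M -> Prop :=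
| scal_span0 : scal_span G 0
| scal_spanD c g u of G g & scal_span G u : scal_span G (c%:A *: g + u).

Lemma scal_span_gen G g : G g -> scal_span G g.
Proof.
move=> Gg; rewrite -[g]addr0 -[g]scale1r -[1](scale1r 1).
by apply: scal_spanD Gg (scal_span0 G).
Qed.

Lemma scal_span_add G m u :
  scal_span G m -> scal_span G u -> scal_span G (m + u).
Proof.
move=> + Gu; elim=> [|c g w Gg _ IH]; first by rewrite add0r.
by rewrite -addrA; apply: scal_spanD.
Qed.

Lemma scal_span_map G G' x : (forall g, G g -> scal_span G' (x *: g)) ->
  forall m, scal_span G m -> scal_span G' (x *: m).
Proof.
move=> GG' m; elim=> [|c g u Gg _ IH]; first by rewrite scaler0; left.
rewrite scalerDr; apply: scal_span_add IH.
rewrite scale_scal_comm; elim: (GG' _ Gg) => [|k h w G'h _ IH].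
  by rewrite scaler0; left.
by rewrite scalerDr scale_scalA; apply: scal_spanD.
Qed.

Lemma scal_spanZ G c m : scal_span G m -> scal_span G (c%:A *: m).
Proof.
apply: scal_span_map => g Gg; rewrite -[_ *: g]addr0.
exact: scal_spanD Gg (scal_span0 G).
Qed.

Lemma sub_scal_span G G' : (forall g, G g -> G' g) ->
  forall m, scal_span G m -> scal_span G' m.
Proof.
move=> GG' m Gm; rewrite -[m]scale1r.
by apply: scal_span_map Gm => g /GG' G'g; rewrite scale1r; apply: scal_span_gen.
Qed.

Lemma horner_alg_eigen x k m (p : {poly K}) :
  x *: m = k%:A *: m -> horner_alg x p *: m = p.[k]%:A *: m.
Proof.
move=> xm; elim/poly_ind: p => [|p c IH].
  by rewrite rmorph0 horner0 !scale0r.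
rewrite rmorphD rmorphM /= horner_algX horner_algC hornerMXaddC.
by rewrite !scalerDl -scalerA xm scale_scal_comm IH scale_scalA mulrC.
Qed.

Lemma horner_alg_span G x (p : {poly K}) m :
  (forall u, scal_span G u -> scal_span G (x *: u)) ->
  scal_span G m -> scal_span G (horner_alg x p *: m).
Proof.
move=> xG; elim/poly_ind: p m => [|p c IH] m Gm.
  by rewrite rmorph0 scale0r; left.
rewrite rmorphD rmorphM /= horner_algX horner_algC scalerDl -scalerA.
by apply: scal_span_add; [apply/IH/xG | apply: scal_spanZ].
Qed.

Lemma horner_algM x (p r : {poly K}) m :
  horner_alg x (p * r) *: m = horner_alg x p *: (horner_alg x r *: m).
Proof. by rewrite rmorphM scalerA. Qed.

Lemma horner_alg_XsubC x k m :
  horner_alg x ('X - k%:P) *: m = x *: m - k%:A *: m.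
Proof. by rewrite rmorphB /= horner_algX horner_algC scalerBl. Qed.

End ScalarSpan.

(** * Irreducibility of a module with a vacuum vector *)

Section HighestWeight.
Variables (K : fieldType) (A : algType K) (I : eqType).
(** In the application an index is a mode [(i, k)], [hp] and [hm] are $h_{i,k+1}$ and
    $h_{i,-(k+1)}$, and [w] is $q^{k+1}$. *)
Variables (hp hm : I -> A) (D DV : A) (w : I -> K).
Variables (M : lmodType A) (v : M) (z c : I -> K) (i0 : I).

Hypothesis char0 : forall k, (k.+1%:R : K) != 0.
Hypotheses (DDV : D * DV = 1) (DVD : DV * D = 1).
Hypothesis w_neq0 : forall i, w i != 0.
Hypothesis D_hp : forall i, D * hp i = w i *: (hp i * D).
Hypothesis D_hm : forall i, D * hm i = (w i)^-1 *: (hm i * D).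
Hypothesis hm_comm : forall i j, hm i * hm j = hm j * hm i.
(** Imposed on [M] and not in [A]: in the algebra the commutator involves powers of $\gamma$, which
    become scalars only on the module. *)
Hypothesis hp_hm : forall i j (m : M),
  hp i *: (hm j *: m) = hm j *: (hp i *: m) + ((i == j)%:R * c i)%:A *: m.
Hypothesis hp_v : forall i, hp i *: v = (z i)%:A *: v.
Hypothesis v_neq0 : v != 0.
(** Cyclicity as an induction principle; $\gamma^{\pm1/2}$ act by scalars and are covered by the
    closure under [k%:A]. *)
Hypothesis v_gen : forall W : M -> Prop, W v ->
  (forall m u, W m -> W u -> W (m + u)) ->
  (forall k m, W m -> W (k%:A *: m)) ->
  (forall i m, W m -> W (hp i *: m)) -> (forall i m, W m -> W (hm i *: m)) ->
  (forall m, W m -> W (D *: m)) -> (forall m, W m -> W (DV *: m)) ->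
  forall m, W m.
Hypothesis c_neq0 : forall i, c i != 0.
Hypothesis z_neq0 : z i0 != 0.
Hypothesis w_generic : forall k, w i0 ^+ k.+1 != 1.

Implicit Types (i j : I) (m u : M) (s S : seq I).

(** * Monomials in the creation operators *)

Definition mon s : M := foldr (fun i m => hm i *: m) v s.

(** The bound on the length is strict, so level 0 is the zero space. The finite list [S] of modes is
    recorded to make the number operator a finite sum. *)
Definition fock_upto S d : M -> Prop :=
  scal_span (fun m => exists2 s, (size s < d)%N & {subset s <= S} /\ m = mon s).

Lemma fock_upto_mon S d s :
  (size s < d)%N -> {subset s <= S} -> fock_upto S d (mon s).
Proof. by move=> sd sS; apply: scal_span_gen; exists s. Qed.

Lemma fock_upto_widen S S' d d' m : {subset S <= S'} -> (d <= d')%N ->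
  fock_upto S d m -> fock_upto S' d' m.
Proof.
move=> SS' dd'; apply: sub_scal_span => _ [s sd [sS ->]].
by exists s; [apply: leq_trans sd dd'|split=> // i /sS /SS'].
Qed.

Lemma fock_upto0 S m : fock_upto S 0 m -> m = 0.
Proof. by case=> // k g u []. Qed.

Lemma fock_upto_hm S d i m : i \in S ->
  fock_upto S d m -> fock_upto S d.+1 (hm i *: m).
Proof.
move=> iS; apply: scal_span_map => _ [s sd [sS ->]].
apply: (@fock_upto_mon _ _ (i :: s)) => // j.
by rewrite inE => /orP[/eqP ->|/sS].
Qed.

(** The shifted operator kills [v], and moving it past a factor [hm j] costs only a scalar in place
    of that factor, so every surviving term is one factor shorter. *)
Lemma lower_mon S d i s : (size s <= d)%N -> {subset s <= S} ->
  fock_upto S d ((hp i - (z i)%:A) *: mon s).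
Proof.
elim: s d => [|j s IH] d /=.
  by move=> _ _; rewrite scalerBl hp_v subrr; left.
case: d => // d sd jsS.
have sS : {subset s <= S} by move=> k ks; apply: jsS; rewrite inE ks orbT.
rewrite scalerBl hp_hm addrAC -scale_scal_comm -scalerBr -scalerBl.
apply: scal_span_add.
  by apply: fock_upto_hm; [apply: jsS; rewrite inE eqxx|apply: IH].
by apply/scal_spanZ/fock_upto_mon.
Qed.

Lemma lower_fock S d i m :
  fock_upto S d.+1 m -> fock_upto S d ((hp i - (z i)%:A) *: m).
Proof. by apply: scal_span_map => _ [s sd [sS ->]]; apply: lower_mon. Qed.

Lemma hp_fock S d i m : fock_upto S d m -> fock_upto S d (hp i *: m).
Proof.
case: d m => [m /fock_upto0 ->|d m Sm]; first by rewrite scaler0; left.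
rewrite -[hp i](subrK (z i)%:A) scalerDl.
apply: scal_span_add; last exact: scal_spanZ.
by apply: fock_upto_widen (lower_fock i Sm).
Qed.

(* [Dpow a b] stands for [D^(a - b)], the representation being redundant. *)
Definition Dpow a b : A := DV ^+ b * D ^+ a.
(** The factor $w_i^{b-a}$ that appears when [hp i] is moved past $D^{a-b}$. *)
Definition Dwt a b i : K := w i ^+ b / w i ^+ a.

(** Stated for any [x] so as to cover [hp i] with [k = w i] and [hm i] with [k = (w i)^-1]. *)
Lemma Dpow_comm x k a b : k != 0 -> D * x = k *: (x * D) ->
  x * Dpow a b = (k ^+ b / k ^+ a) *: (Dpow a b * x).
Proof.
move=> k0 Dx.
have xD : x * D = k^-1 *: (D * x) by rewrite Dx scalerA mulVf // scale1r.
have xDV : x * DV = k *: (DV * x).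
  rewrite -[x * DV]mul1r -DVD -mulrA (mulrA D) Dx -!scalerAl -mulrA DDV mulr1.
  by rewrite -scalerAr.
have xDn l : x * D ^+ l = k^-1 ^+ l *: (D ^+ l * x).
  elim: l => [|l IH]; first by rewrite !expr0 scale1r mulr1 mul1r.
  rewrite !exprSr mulrA IH -scalerAl -[_ * x * D]mulrA xD -scalerAr scalerA.
  by rewrite mulrA.
have xDVn l : x * DV ^+ l = k ^+ l *: (DV ^+ l * x).
  elim: l => [|l IH]; first by rewrite !expr0 scale1r mulr1 mul1r.
  rewrite !exprSr mulrA IH -scalerAl -[_ * x * DV]mulrA xDV -scalerAr scalerA.
  by rewrite mulrA.
rewrite /Dpow mulrA xDVn -scalerAl -[_ * x * _]mulrA xDn -scalerAr scalerA.
by rewrite mulrA exprVn.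
Qed.

Lemma hp_Dpow a b i : hp i * Dpow a b = Dwt a b i *: (Dpow a b * hp i).
Proof. exact: Dpow_comm. Qed.

Lemma hm_Dpow a b i :
  hm i * Dpow a b = (Dwt a b i)^-1 *: (Dpow a b * hm i).
Proof.
rewrite (Dpow_comm _ _ _ (D_hm i)) ?invr_eq0 //.
by rewrite /Dwt !exprVn invf_div mulrC invrK.
Qed.

Lemma D_Dpow a b : D * Dpow a b = Dpow a.+1 b.
Proof.
have DC : GRing.comm D DV by rewrite /GRing.comm DDV.
by rewrite /Dpow mulrA (commrX b DC) exprS mulrA.
Qed.

Lemma DV_Dpow a b : DV * Dpow a b = Dpow a b.+1.
Proof. by rewrite /Dpow mulrA exprS. Qed.

Lemma Dpow_diag a : Dpow a a = 1.
Proof.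
elim: a => [|a IH]; first by rewrite /Dpow !expr0 mulr1.
by rewrite /Dpow exprSr exprS -mulrA (mulrA DV) DVD mul1r.
Qed.

Lemma DpowK a b : Dpow b a * Dpow a b = 1.
Proof.
have DC : GRing.comm D DV by rewrite /GRing.comm DDV.
rewrite /Dpow mulrA -(mulrA (DV ^+ a)).
have -> : D ^+ b * DV ^+ b = 1.
  rewrite -exprMn_comm //; by rewrite DDV expr1n.
by rewrite mulr1 -/(Dpow a a) Dpow_diag.
Qed.

Definition graded_upto S d : M -> Prop :=
  scal_span (fun m => exists a b u, fock_upto S d u /\ m = Dpow a b *: u).

Lemma graded_upto_widen S S' d d' m : {subset S <= S'} -> (d <= d')%N ->
  graded_upto S d m -> graded_upto S' d' m.
Proof.
move=> SS' dd'; apply: sub_scal_span => _ [a [b [u [Su ->]]]].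
by exists a, b, u; split=> //; apply: fock_upto_widen Su.
Qed.

(** Every operator passes a power of [D] up to a scalar. Only [hm i] changes the bounds: it adds [i]
    to the modes and one to the length. *)
Lemma graded_exists m : exists S d, graded_upto S d m.
Proof.
elim/v_gen: m => [|m u [S [d Sm]] [S' [d' Su]]|k m [S [d Sm]]
  |i m [S [d Sm]]|i m [S [d Sm]]|m [S [d Sm]]|m [S [d Sm]]].
- exists [::], 1; apply: scal_span_gen; exists 0, 0, v.
  split; first exact: (@fock_upto_mon _ _ [::]).
  by rewrite Dpow_diag scale1r.
- exists (S ++ S'), (maxn d d'); apply: scal_span_add.
    apply: graded_upto_widen Sm; last exact: leq_maxl.
    by move=> i iS; rewrite mem_cat iS.
  apply: graded_upto_widen Su; last exact: leq_maxr.
  by move=> i iS; rewrite mem_cat iS orbT.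
- by exists S, d; apply: scal_spanZ.
- exists S, d; apply: scal_span_map Sm => _ [a [b [u [Su ->]]]].
  rewrite scalerA hp_Dpow scale_algZ -scalerA; apply/scal_spanZ/scal_span_gen.
  by exists a, b, (hp i *: u); split=> //; apply: hp_fock.
- exists (i :: S), d.+1; apply: scal_span_map Sm => _ [a [b [u [Su ->]]]].
  rewrite scalerA hm_Dpow scale_algZ -scalerA; apply/scal_spanZ/scal_span_gen.
  exists a, b, (hm i *: u); split=> //.
  apply: fock_upto_hm; rewrite ?mem_head //.
  by apply: fock_upto_widen Su => // j jS; rewrite inE jS orbT.
- exists S, d; apply: scal_span_map Sm => _ [a [b [u [Su ->]]]].
  rewrite scalerA D_Dpow; apply: scal_span_gen.
  by exists a.+1, b, u.
- exists S, d; apply: scal_span_map Sm => _ [a [b [u [Su ->]]]].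
  rewrite scalerA DV_Dpow; apply: scal_span_gen.
  by exists a, b.+1, u.
Qed.

(** * Polynomials in one annihilation operator *)

Local Notation pol := (horner_alg (hp i0)).

(** Equal powers of [w i0] with different exponents would, after cancellation, make a positive power
    equal to 1. *)
Lemma Dwt_eq1 a b : (Dwt a b i0 == 1) = (a == b).
Proof.
have [->|ab] := eqVneq a b; first by rewrite /Dwt divff ?expf_neq0 ?eqxx.
apply/negbTE; rewrite /Dwt; apply/eqP => /divr1_eq wab.
have gt k l : (k < l)%N -> w i0 ^+ k = w i0 ^+ l -> False.
  move=> kl; rewrite -(subnKC kl) addSnnS exprD -{1}[w i0 ^+ k]mulr1.
  move/(mulfI (expf_neq0 k (w_neq0 i0))) => h.
  by have := w_generic (l - k.+1); rewrite -h eqxx.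
by case: (ltngtP a b) ab => // kl _; apply: gt kl _.
Qed.

(** Moved past [Dpow a b], each linear factor becomes a multiple of [hp i0 - z i0], which lowers the
    length bound; [d] factors bring it to 0. *)
Lemma kill_graded S d a b u : fock_upto S d u ->
  pol (('X - (Dwt a b i0 * z i0)%:P) ^+ d) *: (Dpow a b *: u) = 0.
Proof.
elim: d u => [|d IH] u Su.
  by rewrite (fock_upto0 Su) !scaler0.
rewrite exprSr horner_algM horner_alg_XsubC scalerA hp_Dpow scale_algZ.
rewrite -scale_scalA -scalerBr -scalerA -scale_scal_comm -scalerBr -scalerBl.
by rewrite scale_scal_comm (IH _ (lower_fock i0 Su)) scaler0.
Qed.

(** Concatenate the [d] equal factors that kill each of the finitely many components; since
    polynomials commute, the factors of any component can be applied to it first. *)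
Lemma annihilator_exists m : exists rs : seq K,
  (forall k, k \in rs -> exists a b, k = Dwt a b i0 * z i0) /\
  pol (\prod_(k <- rs) ('X - k%:P)) *: m = 0.
Proof.
have [S [d]] := graded_exists m.
elim=> [|k _ u [a [b [u' [Su' ->]]]] _ [rs [rsP rs0]]].
  by exists [::]; split=> //; rewrite scaler0.
exists (nseq d (Dwt a b i0 * z i0) ++ rs); split=> [l|].
  by rewrite mem_cat => /orP[/nseqP[-> _]|/rsP //]; exists a, b.
rewrite big_cat big_nseq iter_mulr_1 /= scalerDr mulrC !horner_algM.
rewrite !(scale_scal_comm _ k) (kill_graded _ _ Su').
rewrite !scaler0 add0r -horner_algM mulrC horner_algM.
by rewrite rs0 scaler0.
Qed.

(** Only the components with [a != b] are killed, and what remains lies in the Fock part. Their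
    roots avoid [z i0], because [z i0] is nonzero and their weights differ from 1. *)
Lemma fock_projection m : exists rs : seq K,
  z i0 \notin rs /\ exists S d,
  fock_upto S d (pol (\prod_(k <- rs) ('X - k%:P)) *: m).
Proof.
have [S [d]] := graded_exists m.
elim=> [|k _ u [a [b [u' [Su' ->]]]] _ [rs [rsP [S' [d' rsF]]]]].
  by exists [::]; split=> //; exists [::], 0; rewrite scaler0; left.
have [ab|ab] := eqVneq a b.
  exists rs; split=> //; exists (S ++ S'), (maxn d d').
  rewrite scalerDr; apply: scal_span_add; last first.
    apply: fock_upto_widen rsF; last exact: leq_maxr.
    by move=> i iS; rewrite mem_cat iS orbT.
  apply: (@fock_upto_widen S _ d); last 1 first.
  - rewrite scale_scal_comm; apply: scal_spanZ.
    rewrite ab Dpow_diag scale1r; apply: horner_alg_span Su' => m'.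
    exact: hp_fock.
  - by move=> i iS; rewrite mem_cat iS.
  - exact: leq_maxl.
exists (nseq d (Dwt a b i0 * z i0) ++ rs); split.
  rewrite mem_cat negb_or rsP andbT; apply/nseqP => -[/eqP zE _].
  move: zE; rewrite -subr_eq0 -{1}[z i0]mul1r -mulrBl mulf_eq0 subr_eq0.
  by rewrite (negbTE z_neq0) orbF eq_sym Dwt_eq1 (negbTE ab).
exists S', d'.
rewrite big_cat big_nseq iter_mulr_1 /=.
rewrite scalerDr mulrC !horner_algM !(scale_scal_comm _ k).
rewrite (kill_graded _ _ Su') !scaler0 add0r -horner_algM mulrC horner_algM.
by apply: horner_alg_span rsF => m'; apply: hp_fock.
Qed.

(* A polynomial in [hp i0] kills all the components of [m] of nonzero [D]-degree
   but only rescales [m], so [m] has no such component. *)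
Lemma eigen_fock m : hp i0 *: m = (z i0)%:A *: m -> exists S d, fock_upto S d m.
Proof.
move=> hm'; have [rs [zrs [S [d]]]] := fock_projection m.
rewrite (horner_alg_eigen _ hm') => rsF; exists S, d.
suff p0 : (\prod_(k <- rs) ('X - k%:P)).[z i0] != 0.
  rewrite -[m]scale1r -[1](scale1r 1) -(mulVf p0) -scale_scalA.
  exact: scal_spanZ.
by rewrite -[_ == 0]/(root _ _) root_prod_XsubC.
Qed.

(* The number operator: it multiplies a monomial of length [l] in the creation
   operators indexed by [S] by [l]. *)
Definition euler S : A :=
  \sum_(i <- S) (c i)^-1 *: (hm i * (hp i - (z i)%:A)).

(** The commutator of the number operator with [hm j] comes from the single summand [i = j], present
    exactly once as [S] is duplicate-free; there [c j] cancels its inverse. *)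
Lemma euler_hm S j m : uniq S -> j \in S ->
  euler S *: (hm j *: m) = hm j *: (euler S *: m) + hm j *: m.
Proof.
move=> US jS; rewrite /euler !scaler_suml scaler_sumr.
(* The extra term is spread over [S] by a Kronecker delta, so that the two sides can be compared
   summand by summand. *)
rewrite [X in _ = _ + X](_ : _ =
    \sum_(i <- S) (i == j)%:R%:A *: (hm j *: m)); last first.
  rewrite (bigD1_seq j) //= eqxx scale1r scale1r big1 ?addr0 //.
  by move=> i /negbTE ->; rewrite !scale0r.
rewrite -big_split /=; apply: eq_bigr => i _.
rewrite 2!(scale_algZ _ (hm i * _)) -!(scalerA (hm i)).
have -> : (hp i - (z i)%:A) *: (hm j *: m) =
    hm j *: ((hp i - (z i)%:A) *: m) + ((i == j)%:R * c i)%:A *: m.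
  by rewrite !scalerBl hp_hm scalerBr scale_scal_comm addrAC.
rewrite scalerDr scalerDr; congr (_ + _).
  by rewrite scale_scal_comm !(scalerA (hm _)) hm_comm.
rewrite scale_scal_comm scale_scalA mulrC mulfK //.
by case: eqP => [->|_] //; rewrite !scale0r.
Qed.

Lemma euler_mon S s : uniq S -> {subset s <= S} ->
  euler S *: mon s = (size s)%:R%:A *: mon s.
Proof.
move=> US; elim: s => [|j s IH] sS /=.
  rewrite !scale0r /euler scaler_suml big1 // => i _.
  by rewrite scale_algZ -scalerA scalerBl hp_v subrr !scaler0.
rewrite euler_hm // ?sS ?mem_head // IH => [|i iS]; last first.
  by apply: sS; rewrite inE iS orbT.
by rewrite scale_scal_comm -natr1 !scalerDl !scale1r.
Qed.

(* If all annihilators kill [u] then so does [euler S]; the polynomial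
   [prod_(1 <= k <= d) (X - k)] in [euler S] thus scales [u] by a nonzero
   constant, while it kills every nonempty monomial. *)
Lemma vacuum_line S d u : uniq S -> fock_upto S d u ->
  (forall i, i \in S -> (hp i - (z i)%:A) *: u = 0) ->
  exists k : K, u = k%:A *: v.
Proof.
move=> US Su u0.
have Eu : euler S *: u = (0 : K)%:A *: u.
  rewrite !scale0r /euler scaler_suml big_seq big1 // => i iS.
  by rewrite scale_algZ -scalerA u0 // !scaler0.
pose p : {poly K} := \prod_(k <- iota 1 d) ('X - k%:R%:P).
have p0 : p.[0] != 0.
  rewrite /p horner_prod prodf_seq_neq0; apply/allP => -[|k].
    by rewrite mem_iota.
  by rewrite hornerXsubC sub0r oppr_eq0 char0.
suff [k pE] : exists k : K, horner_alg (euler S) p *: u = k%:A *: v.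
  exists (p.[0]^-1 * k); rewrite -scale_scalA -pE (horner_alg_eigen _ Eu).
  by rewrite scale_scalA mulVf // !scale1r.
elim: {u0 Eu} Su => [|k _ u' [s sd [sS ->]] _ [l IH]].
  by exists 0; rewrite !scale0r scaler0.
rewrite scalerDr IH scale_scal_comm (horner_alg_eigen _ (euler_mon US sS)).
rewrite scale_scalA; case: s sd sS => [|j s] sd sS.
  by exists (k * p.[0] + l); rewrite scalerDl scalerDl.
exists l; suff -> : p.[(size (j :: s))%:R] = 0 by rewrite mulr0 !scale0r add0r.
apply/eqP; rewrite horner_prod prodf_seq_eq0; apply/hasP.
exists (size s).+1; last by rewrite hornerXsubC subrr eqxx.
by rewrite mem_iota add1n ltnS; exact: ltnW.
Qed.

(** * Submodules *)

Variable N : {pred M}.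
Hypothesis N_submod : submod_closed N.

Let N_scale x m : m \in N -> x *: m \in N.
Proof.
by move=> Nm; rewrite -[_ *: _]addr0; apply: N_submod.2 => //; exact: N_submod.1.
Qed.

(** Either some lowering operator has a nonzero value on [u], of smaller length, and induction
    applies, or all of them kill [u], which is then a nonzero multiple of [v]. *)
Lemma fock_submod_vacuum S d u : uniq S -> fock_upto S d u ->
  u \in N -> u != 0 -> v \in N.
Proof.
move=> US; elim: d u => [|d IH] u Su Nu u0.
  by rewrite (fock_upto0 Su) eqxx in u0.
have [/hasP[i iS i0']|/hasPn h] :=
    boolP (has (fun i => (hp i - (z i)%:A) *: u != 0) S).
  exact: IH (lower_fock i Su) (N_scale _ Nu) i0'.
have [i iS|k uE] := vacuum_line US Su.
  by apply/eqP; move: (h i iS); rewrite negbK.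
have k0 : k != 0 by apply: contra_neq u0 => k0; rewrite uE k0 !scale0r.
rewrite -[v]scale1r -[1](scale1r 1) -(mulVf k0) -scale_scalA -uE.
exact: N_scale.
Qed.

(** Peel off the factors of an annihilating polynomial: the first one that kills the current nonzero
    vector exhibits it as an eigenvector. *)
Lemma submod_eigen m : m \in N -> m != 0 ->
  exists2 u, u \in N /\ u != 0 & hp i0 *: u = (z i0)%:A *: u.
Proof.
have [rs [rsP]] := annihilator_exists m.
elim: rs m rsP => [|k rs IH] m rsP.
  by rewrite big_nil rmorph1 scale1r => ->; rewrite eqxx.
rewrite big_cons mulrC horner_algM horner_alg_XsubC => m0 Nm mn0.
have [/eqP|kn0] := eqVneq (hp i0 *: m - k%:A *: m) 0; last first.
  apply: IH m0 _ kn0 => [l lrs|]; first by apply: rsP; rewrite inE lrs orbT.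
  by rewrite -scalerBl; apply: N_scale.
rewrite subr_eq0 => /eqP hk.
have [a [b kE]] := rsP k (mem_head _ _).
(* The inverse shift multiplies the eigenvalue by the inverse of [Dwt a b i0], turning it into
   [z i0]; being invertible, it keeps the vector nonzero. *)
exists (Dpow b a *: m).
  split; first exact: N_scale.
  apply: contra_neq mn0 => m0'.
  by rewrite -[m]scale1r -(DpowK b a) -scalerA m0' scaler0.
rewrite scalerA hp_Dpow scale_algZ -scalerA hk kE scale_scal_comm scale_scalA.
rewrite mulrA [_ * Dwt _ _ _](_ : _ = 1) ?mul1r //.
by rewrite /Dwt mulrA mulfVK ?expf_neq0 // divff // expf_neq0.
Qed.

Lemma submod_trivial : (forall m, m \in N -> m = 0) \/ (forall m, m \in N).
Proof.
have [vN|vN] := boolP (v \in N); [right|left].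
  elim/v_gen => //; try by move=> *; apply: N_scale.
  by move=> m u Nm Nu; rewrite -[m]scale1r; apply: N_submod.2.
move=> m Nm; apply/eqP; apply: contraNT vN => m0.
have [u [Nu u0] /eigen_fock[S [d Su]]] := submod_eigen Nm m0.
apply: (@fock_submod_vacuum (undup S) d u) Nu u0; first exact: undup_uniq.
by apply: fock_upto_widen Su => // i; rewrite mem_undup.
Qed.

End HighestWeight.

(** * The quantum Heisenberg algebra *)

Section HeisRelations.
Variables (R : realType) (P : qpowers R) (n : nat).
Local Notation K := (qfield P).
Local Notation q := (qq P).

(* Naming the algebra structure keeps all the inferred ring and module
   structures on a single inheritance path, so that rewriting can match them. *)
Definition heis_alg : algType K := heis P n.
Local Notation H := heis_alg.

Definition heis_cls (t : aterm K (heis_gen n)) : H := pcls (@heis_rel R P n) t.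
Local Notation cls := heis_cls.
Local Notation h i r := (cls (tH P i r)).
Local Notation G := (cls (tG P n)).
Local Notation GV := (cls (tGV P n)).
Local Notation D := (cls (tD P n)).
Local Notation DV := (cls (tDV P n)).

(** Counting from 0 makes nonvanishing automatic: mode [k] has degree $k+1$, and $-(k+1)$ for its
    negative counterpart. *)
Definition nzpos (k : nat) : nzint := exist _ (Posz k.+1) isT.
Definition nzneg (k : nat) : nzint := exist _ (Negz k) isT.

Lemma nzint_ind (Q : nzint -> Prop) :
  (forall k, Q (nzpos k)) -> (forall k, Q (nzneg k)) -> forall r, Q r.
Proof.
move=> Qp Qn [[[|k]|k] r0] //.
  by rewrite (_ : exist _ _ _ = nzpos k); [apply: Qp | apply: val_inj].
by rewrite (_ : exist _ _ _ = nzneg k); [apply: Qn | apply: val_inj].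
Qed.

Lemma clsD s t : cls (s + t)%A = cls s + cls t :> H. Proof. exact: pclsE_D. Qed.
Lemma clsN t : cls (- t)%A = - cls t :> H. Proof. exact: pclsE_N. Qed.
Lemma clsM s t : cls (s * t)%A = cls s * cls t :> H. Proof. exact: pclsE_M. Qed.
Lemma clsC c : cls (TCst c) = c%:A :> H. Proof. exact: pclsE_C. Qed.
Lemma cls_rel s t : heis_rel s t -> cls s = cls t :> H.
Proof. by move=> st; apply/pclsP/peq_rel. Qed.

Lemma gammahK : G * GV = 1.
Proof. by rewrite -clsM (cls_rel (rel_GGV _ _)). Qed.
Lemma gammahVK : GV * G = 1.
Proof. by rewrite -clsM (cls_rel (rel_GVG _ _)). Qed.
Lemma DgenK : D * DV = 1.
Proof. by rewrite -clsM (cls_rel (rel_DDV _ _)). Qed.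
Lemma DgenVK : DV * D = 1.
Proof. by rewrite -clsM (cls_rel (rel_DVD _ _)). Qed.

Lemma Dgen_hgen i r : D * h i r = q ^ val r *: (h i r * D).
Proof.
have e : D * h i r * DV = q ^ val r *: h i r.
  by rewrite -!clsM (cls_rel (rel_Dh P i r)) clsM clsC mulr_algl.
by rewrite scalerAl -e -[_ * DV * _]mulrA DgenVK mulr1.
Qed.

Lemma cls_ind (Q : H -> Prop) : (forall t, Q (cls t)) -> forall x, Q x.
Proof. exact: pcls_ind. Qed.

Lemma gammah_central (x : H) : x * G = G * x.
Proof.
elim/cls_ind: x; elim => [[i r||||]|c|s IHs t IHt|t IHt|s IHs t IHt].
- by rewrite -!clsM (cls_rel (rel_Gh _ _ _)).
- by [].
- by rewrite gammahK gammahVK.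
- by rewrite -!clsM (cls_rel (rel_DG _ _)).
(* For [DV] the commutation is obtained by conjugating the relation for [D]. *)
- have DG : D * G = G * D.
    by rewrite -!clsM (cls_rel (rel_DG _ _)).
  rewrite -[LHS]mulr1 -DgenK mulrA -[DV * _ * _]mulrA -DG.
  by rewrite mulrA DgenVK mul1r.
- by rewrite clsC mulr_algl mulr_algr.
- by rewrite clsD mulrDl mulrDr IHs IHt.
- by rewrite clsN mulNr mulrN IHt.
- by rewrite clsM -mulrA IHt mulrA IHs mulrA.
Qed.

Lemma heis_gen_ind (Q : H -> Prop) :
  (forall c, Q c%:A) -> (forall x y, Q x -> Q y -> Q (x + y)) ->
  (forall x y, Q x -> Q y -> Q (x * y)) ->
  (forall i r, Q (h i r)) -> Q (G) -> Q (GV) ->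
  Q (D) -> Q (DV) -> forall x, Q x.
Proof.
move=> QC QD QM Qh QG QGV QD1 QDV; elim/cls_ind.
elim=> [[i r||||]|c|s IHs t IHt|t IHt|s IHs t IHt] //.
- exact: Qh.
- by rewrite clsC.
- by rewrite clsD; apply: QD.
- by rewrite clsN -mulN1r -scaleN1r; apply: QM.
- by rewrite clsM; apply: QM.
Qed.

(** A positive power of $q$ is the image, under an injective map, of a nonconstant monomial in the
    indeterminate $q^{1/2}$. *)
Lemma qq_expn_neq1 k : q ^+ k.+1 != 1.
Proof.
apply/eqP; rewrite /qq -exprM /qhalf -rmorphXn /= -[1](rmorph1 (qincl P)).
move/fmorph_inj => h; have := @Xfrac_expz_eq1 R (2 * k.+1)%N.
by move=> /(_ h).
Qed.

Lemma natr_qfield_neq0 k : (k.+1%:R : K) != 0.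
Proof.
rewrite -(rmorph_nat (qincl P)) fmorph_eq0 -(rmorph_nat (@tofrac {poly R[i]})).
by rewrite tofrac_eq0 -polyC_natr polyC_eq0 pnatr_eq0.
Qed.

(** With $b = a/2$ this is the central charge $(q^{ar}-q^{-ar})/(q-q^{-1})$, $r = k+1$. It is
    nonzero because $q^{mb} = 1 = q^0$ forces $mb = 0$ by injectivity of the exponents. *)
Lemma hcoef_neq0 (b : R[i]) k : b \in qexps P -> b != 0 ->
  hcoef (qpow P b) (Posz k.+1) != 0.
Proof.
move=> bP b0.
have g0 := qpow_neq0 bP.
have pX m : qpow P (b *+ m) = qpow P b ^+ m.
  elim: m => [|m IH]; last by rewrite mulrS exprS -IH qpowD // rpredMn.
  rewrite mulr0n expr0; apply: (mulfI g0).
  by rewrite mulr1 -qpowD ?rpred0 // addr0.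
have gX m : qpow P b ^+ m.+1 != 1.
  apply/negP => /eqP; rewrite -pX => e.
  have : b *+ m.+1 = 0.
    apply: (qpow_inj (q := P)); rewrite ?rpredMn ?rpred0 //.
    rewrite e; apply: (mulfI g0).
    by rewrite mulr1 -qpowD ?rpred0 // addr0.
  by move/eqP; rewrite mulrn_eq0 (negbTE b0).
(* Used twice: for the numerator with $x = q^b$ and for the denominator with $x = q$, [m = 1]. *)
have main (F : fieldType) (x : F) m :
    x != 0 -> x ^+ (m + m) != 1 -> x ^+ m - (x ^+ m)^-1 != 0.
  move=> x0; apply: contraNneq => /eqP; rewrite subr_eq0 => /eqP h.
  by rewrite exprD {2}h mulfV // expf_neq0.
rewrite /hcoef mulf_neq0 // ?invr_eq0.
  rewrite /gpow mulNr -exprnN; apply: main => //; exact: gX.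
rewrite -{1}[q]expr1 -{2}[q]expr1; apply: main; first exact: qq_neq0.
exact: qq_expn_neq1.
Qed.

(** * Modules on which gamma acts by a scalar *)

Section Module.
Variables (g : K) (M : lmodType H).
Hypothesis g_neq0 : g != 0.
Hypothesis gammaM : forall m : M, G *: m = g%:A *: m.

Lemma gammahV_act (m : M) : GV *: m = g^-1%:A *: m.
Proof.
have e : G *: (GV *: m) = m by rewrite scalerA gammahK scale1r.
by rewrite -{2}e gammaM scale_scalA mulVf // !scale1r.
Qed.

Lemma tgamma_act r (m : M) : cls (tgamma P n r) *: m = (gpow g r)%:A *: m.
Proof.
have GX t c : (forall m : M, cls t *: m = c%:A *: m) ->
    forall k (m' : M), cls (tpow t k) *: m' = (c ^+ k)%:A *: m'.
  move=> tc; elim=> [|k IH] m' /=; first by rewrite clsC.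
  by rewrite clsM -scalerA IH tc scale_scalA exprS.
case: r => k.
  by rewrite (GX _ g) // /gpow -muln2.
rewrite (GX _ g^-1) /gpow; last exact: gammahV_act.
by rewrite NegzE mulNr -exprnN -muln2 exprVn.
Qed.

Lemma hgen_comm_act i j (r s : nzint) (m : M) :
  h i r *: (h j s *: m) = h j s *: (h i r *: m) +
    (((i == j) && (val r + val s == 0))%:R * hcoef g (val r))%:A *: m.
Proof.
have -> : h i r *: (h j s *: m) =
    h j s *: (h i r *: m) + (h i r * h j s - h j s * h i r) *: m.
  by rewrite scalerBl -(scalerA (h i r)) -(scalerA (h j s)) addrC subrK.
congr (_ + _); rewrite -!clsM -clsN -clsD (cls_rel (rel_hh P i r j s)).
rewrite clsM clsC clsD clsN -(scalerA _%:A) scalerBl !tgamma_act -!scalerBl.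
by rewrite scale_scalA /hcoef -mulrA [_^-1 * _]mulrC.
Qed.

Lemma hgen_neg_comm i j k l :
  h i (nzneg k) * h j (nzneg l) = h j (nzneg l) * h i (nzneg k).
Proof.
have := cls_rel (rel_hh P i (nzneg k) j (nzneg l)).
rewrite !(clsD, clsN, clsM, clsC) /= andbF mul0r scale0r mul0r => /eqP.
by rewrite subr_eq0 => /eqP.
Qed.
End Module.

Lemma cyclic_submod_trivial (b : R[i]) (M : lmodType H) (v : M)
    (z : 'I_n -> nat -> K) (N : {pred M}) :
  b \in qexps P -> b != 0 ->
  v != 0 -> (forall m : M, exists x : H, m = x *: v) ->
  (forall i k, h i (nzpos k) *: v = (z i k)%:A *: v) ->
  G *: v = (qpow P b)%:A *: v -> (exists i k, z i k != 0) ->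
  submod_closed N -> (forall m, m \in N -> m = 0) \/ (forall m, m \in N).
Proof.
move=> bP b0 v0 cyc hv Gv [i0 [k0 z0]] N_submod.
(* The central element $\gamma^{1/2}$ is a scalar on the generator, hence on the whole cyclic
   module. *)
have GM (m : M) : G *: m = (qpow P b)%:A *: m.
  have [x ->] := cyc m.
  by rewrite scalerA -gammah_central -scalerA Gv scale_scal_comm.
have g0 := qpow_neq0 bP.
pose I := ('I_n * nat)%type.
apply: (@submod_trivial K H I (fun p => h p.1 (nzpos p.2))
  (fun p => h p.1 (nzneg p.2)) D DV (fun p => q ^+ p.2.+1) M v
  (fun p => z p.1 p.2) (fun p => hcoef (qpow P b) (Posz p.2.+1)) (i0, k0)) => //.
- exact: natr_qfield_neq0.
- exact: DgenK.
- exact: DgenVK.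
- by move=> p; rewrite expf_neq0 // qq_neq0.
- by move=> p; rewrite Dgen_hgen.
- by move=> p; rewrite Dgen_hgen.
- by move=> p p'; rewrite hgen_neg_comm.
- move=> [i k] [j l] m /=; rewrite (hgen_comm_act g0 GM) /=.
  congr (_ + _ *: _); congr ((_%:R * _)%:A); rewrite xpair_eqE; congr (_ && _).
  by apply/eqP/eqP; lia.
- move=> W Wv WD WZ Whp Whm WDg WDV m; have [x ->] := cyc m.
  (* The vector is generalized because, for a product [x * y], the hypothesis on [x] is applied to
     [y *: m']. *)
  move: v Wv {v0 cyc hv Gv}; elim/heis_gen_ind: x => //.
  + by move=> x y IHx IHy m' Wm; rewrite scalerDl; apply: WD; auto.
  + by move=> x y IHx IHy m' Wm; rewrite -scalerA; auto.
  + by move=> i; elim/nzint_ind=> k m' Wm;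
      [apply: (Whp (i, k))|apply: (Whm (i, k))].
  + by move=> m' Wm; rewrite GM; apply: WZ.
  + by move=> m' Wm; rewrite (gammahV_act g0 GM); apply: WZ.
- by move=> p; apply: hcoef_neq0.
- by move=> k; rewrite -exprM mulSn addSn qq_expn_neq1.
Qed.

End HeisRelations.

(** * The induced module *)

Section TensorTheory.
Variables (B H : pzRingType) (f : {rmorphism B -> H}) (V : lmodType B).

Lemma tensor_scale x y (u : V) : x *: pure f y u = pure f (x * y) u.
Proof. by rewrite -[LHS]/(tscale x (tcls _ _)) -tclsZ. Qed.

Lemma pure_balanced x b (u : V) : pure f (x * f b) u = pure f x (b *: u).
Proof. exact/tclsP/teq_pureM. Qed.

Lemma tensor_ind (Q : tensor f V -> Prop) :
  (forall x u, Q (pure f x u)) -> Q 0 -> (forall s t, Q s -> Q t -> Q (s + t)) ->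
  (forall t, Q t -> Q (- t)) -> forall t, Q t.
Proof.
move=> Qp Q0 QD QN; elim/tcls_ind; elim=> [x u||s Qs t Qt|t Qt].
- exact: Qp.
- exact: Q0.
- by rewrite tclsD; apply: QD.
- by rewrite tclsN; apply: QN.
Qed.

(** The universal property of the tensor product: evaluation of formal sums by recursion respects
    the defining congruence. *)
Lemma tensor_lift (W : zmodType) (phi : H -> V -> W) :
  (forall x y u, phi (x + y) u = phi x u + phi y u) ->
  (forall x u w, phi x (u + w) = phi x u + phi x w) ->
  (forall x b u, phi (x * f b) u = phi x (b *: u)) ->
  exists F : tensor f V -> W, F 0 = 0 /\ forall x u, F (pure f x u) = phi x u.
Proof.
move=> phiDl phiDr phiM.
pose F := fix F (t : tterm H V) : W := match t with
  | TPure x u => phi x u | TZero => 0 | TPlus s t => F s + F t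
  | TMinus t => - F t end.
have FP s t : teq f s t -> F s = F t.
  elim=> {s t} //=.
  - by move=> s t u _ -> _ ->.
  - by move=> s s' t t' _ -> _ ->.
  - by move=> s s' _ ->.
  - by move=> s t u; rewrite addrA.
  - by move=> s t; rewrite addrC.
  - by move=> t; rewrite add0r.
  - by move=> t; rewrite addNr.
exists (fun x => F (repr x)); split=> [|x u].
  exact: (FP _ _ (teq_repr f TZero)).
exact: (FP _ _ (teq_repr f (TPure x u))).
Qed.

End TensorTheory.

Section VermaModule.
Variables (R : realType) (P : qpowers R) (n : nat) (a : R[i]).
Variables (a_exp : a / 2 \in qexps P) (zeta : hom_plus P n).
Local Notation K := (qfield P).
Local Notation H := (heis_alg P n).
Local Notation chi := (bor_char a_exp zeta).

Definition hwvec : Mq a_exp zeta := pure (@bor_incl R P n) 1 (1 : line chi).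

Lemma bor_incl_scal (c : K) : @bor_incl R P n c%:A = c%:A.
Proof. by []. Qed.

Lemma bor_hwvec (b : heis_bor P n) :
  bor_incl b *: hwvec = pure (@bor_incl R P n) 1 (chi b : line chi).
Proof.
rewrite tensor_scale mulr1 -[bor_incl b]mul1r pure_balanced.
by congr pure; rewrite -[LHS]/(chi b * 1) mulr1.
Qed.

Lemma pure1_hwvec (c : K) :
  pure (@bor_incl R P n) 1 (c : line chi) = (c%:A : heis P n) *: hwvec.
Proof.
rewrite -bor_incl_scal bor_hwvec; congr pure.
by rewrite linearZ /= rmorph1 mulr1.
Qed.

Lemma bor_act_hwvec (b : heis_bor P n) :
  bor_incl b *: hwvec = ((chi b)%:A : heis P n) *: hwvec.
Proof. by rewrite bor_hwvec pure1_hwvec. Qed.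

Lemma hwvec_cyclic (m : Mq a_exp zeta) : exists x : heis P n, m = x *: hwvec.
Proof.
elim/tensor_ind: m => [x u||s t [x ->] [y ->]|t [x ->]].
(* The coordinate [u] on the line is moved across the tensor sign as a scalar of the algebra. *)
- exists (x * u%:A); rewrite -scalerA -pure1_hwvec tensor_scale mulr1.
  by [].
- by exists 0; rewrite scale0r.
- by exists (x + y); rewrite scalerDl.
- by exists (- x); rewrite scaleNr.
Qed.

(** * Comparison with the Fock space *)

Local Notation g := (qpow P (a / 2)).
Local Notation vac := (@vacuum R P n).
Local Notation lact := (fock_lact zeta g).
Let g_neq0 : g != 0 := qpow_neq0 a_exp.

Lemma fock_lactD x y w : lact (x + y) w = lact x w + lact y w.
Proof. exact: (pactD (fock_act_lin zeta g) (fock_rel zeta g_neq0)). Qed.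

Lemma fock_lactM x y w : lact (x * y) w = lact x (lact y w).
Proof. exact: (pactM (fock_act_lin zeta g) (fock_rel zeta g_neq0)). Qed.

Lemma fock_lact1 w : lact 1 w = w.
Proof. exact: (pact1 (fock_act_lin zeta g) (fock_rel zeta g_neq0)). Qed.

Lemma fock_lact_scal (c : K) w : lact c%:A w = c *: w.
Proof.
rewrite /fock_lact (pactZ (fock_act_lin zeta g) (fock_rel zeta g_neq0)).
by rewrite [pact _ _ _]fock_lact1.
Qed.

Lemma fock_lactZ x (c : K) w : lact x (c *: w) = c *: lact x w.
Proof.
by rewrite -!fock_lact_scal -!fock_lactM mulr_algl mulr_algr.
Qed.

Lemma fock_lact_gammah w : lact (gammah P n) w = g *: w.
Proof. exact: (pact_cls (fock_act_lin zeta g) (fock_rel zeta g_neq0)). Qed.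

(** The character is obtained by choice and known only through its values on the positive part and
    on $\gamma^{1/2}$; these determine it, by induction over the generated subalgebra. *)
Lemma bor_char_vacuum (b : heis_bor P n) : lact (val b) vac = chi b *: vac.
Proof.
have [chi_plus chi_gamma] := bor_charP a_exp zeta.
have bor x (xS : in_subalg (@bor_gens R P n) x) :
    exists b' : heis_bor P n, val b' = x.
  by exists (exist _ x (introT (subalg_predP _ _) xS)).
have : in_subalg (@bor_gens R P n) (val b) by exact/subalg_predP/(valP b).
move: {-2}(val b) (erefl (val b)) => x + xS; move: b.
elim: xS => {x} [x xg b bx|c b bx|x y xS IHx yS IHy b bx|x y xS IHx yS IHy b bx].
- have [b' b'G] : exists b' : heis_bor P n, val b' = gammah P n.
    by apply/bor/in_subalg_gen; right; left.
  case: xg => [xp|[xG|xGV]].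
  + pose y : heis_plus P n := exist _ x (introT (subalg_predP _ _) xp).
    by rewrite (chi_plus b y) // -(plus_vacuum zeta g_neq0 y).
  + by rewrite xG fock_lact_gammah (chi_gamma b) -?bx.
  + have bb' : b * b' = 1.
      apply: val_inj; rewrite -[LHS]/(val b * val b') -bx b'G xGV.
      exact: gammahVK.
    have cg : chi b * chi b' = 1 by rewrite -rmorphM bb' rmorph1.
    rewrite (chi_gamma b' b'G) in cg.
    have GVG : gammahV P n * gammah P n = 1 := gammahVK P n.
    have <- : lact (gammahV P n * gammah P n) (chi b *: vac) = chi b *: vac.
      by rewrite GVG fock_lact1.
    rewrite fock_lactM fock_lact_gammah scalerA [g * _]mulrC cg scale1r.
    by rewrite xGV.
- have -> : b = c%:A by apply/val_inj; rewrite -bx.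
  by rewrite linearZ /= rmorph1 mulr1 fock_lact_scal.
- have [b1 b1x] := bor _ xS; have [b2 b2y] := bor _ yS.
  have -> : b = b1 + b2 by apply/val_inj; rewrite -bx -b1x -b2y.
  by rewrite rmorphD scalerDl fock_lactD (IHx b1) // (IHy b2).
- have [b1 b1x] := bor _ xS; have [b2 b2y] := bor _ yS.
  have -> : b = b1 * b2 by apply/val_inj; rewrite -bx -b1x -b2y.
  by rewrite rmorphM fock_lactM (IHy b2) // fock_lactZ (IHx b1) // scalerA mulrC.
Qed.

(** Sending $x \otimes c$ to $c\,x$ applied to the Fock vacuum is balanced, because the vacuum is an
    eigenvector for the same character; the generator goes to the vacuum, which is nonzero. *)
Lemma hwvec_neq0 : hwvec != 0.
Proof.
have [|||F [F0 Fpure]] := @tensor_lift _ _ (@bor_incl R P n) (line chi) (fock P n)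
    (fun x (c : line chi) => (c : K) *: lact x vac).
- by move=> x y u; rewrite fock_lactD scalerDr.
- by move=> x u w; rewrite scalerDl.
- move=> x b u; rewrite fock_lactM [lact (bor_incl b) _]bor_char_vacuum fock_lactZ.
  by rewrite scalerA mulrC.
apply/eqP => v0; have := Fpure 1 (1 : K).
rewrite -[pure _ _ _]/hwvec v0 F0 scale1r fock_lact1.
move/(congr1 (fun u : fock P n => u 0 (fun _ _ => 0%N))); rewrite vacuum0.
by move/eqP; rewrite eq_sym oner_eq0.
Qed.

Lemma Mq_irreducible :
  a != 0 -> hom_nonzero zeta -> irreducible_lmod (Mq a_exp zeta).
Proof.
move=> a0 [i0 [r0 [r0_gt0 z0]]]; split; first by exists hwvec; apply: hwvec_neq0.
move=> N NS.
have [chi_plus chi_gamma] := bor_charP a_exp zeta.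
have plus_bor (y : heis_plus P n) : val y \in subalg_pred (@bor_gens R P n).
  by apply/subalg_predP/in_subalg_gen; left; apply/subalg_predP/(valP y).
have gamma_bor : gammah P n \in subalg_pred (@bor_gens R P n).
  by apply/subalg_predP/in_subalg_gen; right; left.
pose z (i : 'I_n) (k : nat) : K := zeta (@hplus R P n i (nzpos k) isT).
apply: (@cyclic_submod_trivial R P n (a / 2) (Mq a_exp zeta) hwvec z N a_exp) => //.
- by rewrite mulf_neq0 // invr_eq0 pnatr_eq0.
- exact: hwvec_neq0.
- exact: hwvec_cyclic.
- move=> i k; pose y := @hplus R P n i (nzpos k) isT.
  have := bor_act_hwvec (exist _ (val y) (plus_bor y)).
  by rewrite (chi_plus _ y).
- have := bor_act_hwvec (exist _ (gammah P n) gamma_bor).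
  by rewrite chi_gamma.
(* A positive [r0] has the form [nzpos k]; its positivity proof is identified with the one built
   into [z]. *)
- exists i0; move: r0_gt0 z0; elim/nzint_ind: r0 => [k|k] // kpos zk.
  by exists k; rewrite /z; move: zk; rewrite (bool_irrelevance kpos isT).
Qed.

End VermaModule.

Unset Implicit Arguments.

Theorem theorem6p7 (R : realType) (P : qpowers R) (n : nat) (n_gt0 : (0 < n)%N)
    (a : R[i]) (a_neq0 : a != 0) (a_exp : a / 2 \in qexps P)
    (zeta : hom_plus P n) (zeta_neq0 : hom_nonzero zeta) :
  irreducible_lmod (Mq a_exp zeta).
Proof. exact: Mq_irreducible. Qed.
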